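(* Fix $T>0$ and let $\mu$ be the law of white noise on $H^{-1-}(\mathbb{T}^2)$. Let $\rho_0\in C_b(H^{-1-}(\mathbb{T}^2))$, $\rho_0\ge0$, $\int\rho_0\,d\mu=1$. Let $\rho:[0,T]\times H^{-1-}(\mathbb{T}^2)\to[0,\|\rho_0\|_\infty]$ be a bounded measurable function with $\rho(0,\cdot)=\rho_0$ $\mu$-a.e. for which there exist a probability space $(\Xi,\mathcal{F},P)$ and a measurable map $\omega_\cdot:\Xi\times[0,T]\to C^\infty(\mathbb{T}^2)'$ such that $\omega_\cdot$ is a $\rho$-white noise solution of the Euler equations and is the limit, $P$-a.s. in $C([0,T];H^{-1-}(\mathbb{T}^2))$, of a sequence of random point vortices. Then $\rho$ is a bounded weak solution of the continuity equation $$\partial_t\rho_t+\operatorname{div}_\mu(\rho_tb)=0$$ with initial condition $\rho_0$.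
   Context: $\mathbb{T}^2=\mathbb{R}^2/\mathbb{Z}^2$. $\langle\cdot,\cdot\rangle$ is the duality between distributions and test functions. With $e_n(x)=e^{2\pi i n\cdot x}$ and $\widehat\omega(n)=\langle\omega,e_n\rangle$, $H^s(\mathbb{T}^2)$ is the space of (real) distributions with $\|\omega\|_{H^s}^2=\sum_{n\in\mathbb{Z}^2}(1+|n|^2)^s|\widehat\omega(n)|^2<\infty$; similarly on $\mathbb{T}^2\times\mathbb{T}^2$. $H^{-1-}(\mathbb{T}^2)=\bigcap_{\epsilon>0}H^{-1-\epsilon}(\mathbb{T}^2)$ with metric $d_{H^{-1-}}(\omega,\omega')=\sum_{n\ge1}2^{-n}(\|\omega-\omega'\|_{H^{-1-1/n}}\wedge1)$; $C([0,T];H^{-1-}(\mathbb{T}^2))$ has the metric $\sup_{t}d_{H^{-1-}}(\omega_t,\omega'_t)$. $H^{2+}(\mathbb{T}^2\times\mathbb{T}^2)=\bigcup_{\epsilon>0}H^{2+\epsilon}(\mathbb{T}^2\times\mathbb{T}^2)$. If $\omega\in H^{-1-}(\mathbb{T}^2)$ then $\omega\otimes\omega$ (defined by $\langle\omega\otimes\omega,\phi\otimes\psi\rangle=\langle\omega,\phi\rangle\langle\omega,\psi\rangle$) pairs with every $f\in H^{2+}(\mathbb{T}^2\times\mathbb{T}^2)$. White noise: a random distribution $\omega$ with $\langle\omega,\phi\rangle$ centered Gaussian for all $\phi\in C^\infty(\mathbb{T}^2)$ and $\mathbb{E}[\langle\omega,\phi\rangle\langle\omega,\psi\rangle]=\langle\phi,\psi\rangle_{L^2}$;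 it lives a.s. in $H^{-1-}(\mathbb{T}^2)$, and $\mu$ is its law there. Biot-Savart kernel: $K=(\partial_2G,-\partial_1G)$, $G$ the zero-mean solution of $\Delta G=\delta_0-1$ on $\mathbb{T}^2$; $K$ is smooth off $0$, odd, $|K(x)|\le C/|x|$ near $0$; set $K(0)=0$. For $\phi\in C^\infty(\mathbb{T}^2)$, $H_\phi(x,y)=\frac12K(x-y)\cdot(\nabla\phi(x)-\nabla\phi(y))$. Call a sequence $H_\phi^n\in H^{2+}(\mathbb{T}^2\times\mathbb{T}^2)$ of symmetric functions admissible if $\int\int(H^n_\phi-H_\phi)^2dxdy\to0$ and $\int H^n_\phi(x,x)dx\to0$. The function $\omega\mapsto\langle\omega\otimes\omega,H_\phi\rangle\in L^2(\mu)$ is the $L^2(\mu)$-limit of $\langle\omega\otimes\omega,H_\phi^n\rangle$ for any admissible sequence (it exists and is independent of the sequence). $\rho$-white noise solution: let $\rho:[0,T]\times H^{-1-}(\mathbb{T}^2)\to[0,\infty)$, $\rho_t=\rho(t,\cdot)$, satisfy $\int\rho_t^q\,d\mu\le C$ for some $C>0$, $q>1$, and $\int\rho_t\,d\mu=1$, for every $t$. Let $\omega_\cdot:\Xi\times[0,T]\to C^\infty(\mathbb{T}^2)'$ be measurable with trajectories in $C([0,T];H^{-1-}(\mathbb{T}^2))$ and $\omega_t$ of law $\rho_t\,d\mu$ for every $t\in[0,T]$. The process $s\mapsto\langle\omega_s\otimes\omega_s,H_\phi\rangle$ is the limit in $L^1(\Xi;L^1(0,T))$ of $s\mapsto\langle\omega_s\otimes\omega_s,H^n_\phi\rangle$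 for any admissible sequence. $\omega_\cdot$ is a $\rho$-white noise solution of the Euler equations if for every $\phi\in C^\infty(\mathbb{T}^2)$, $t\mapsto\langle\omega_t,\phi\rangle$ is continuous and, $P$-a.s., uniformly in $t\in[0,T]$, $\langle\omega_t,\phi\rangle=\langle\omega_0,\phi\rangle+\int_0^t\langle\omega_s\otimes\omega_s,H_\phi\rangle ds$. Random point vortices: a process $\omega^N_t=\frac1{\sqrt N}\sum_{i=1}^N\xi_i\delta_{X^{i,N}_t}$, where $((\xi_i,X^{i,N}_0))_{i\le N}$ is a random vector in $(\mathbb{R}\times\mathbb{T}^2)^N$ and, a.s., the $X_t^{i,N}$ are pairwise distinct for all $t$ and solve $\frac{dX_t^{i,N}}{dt}=\sum_{j=1}^N\frac1{\sqrt N}\xi_jK(X_t^{i,N}-X_t^{j,N})$. Test functionals: $\mathcal{FC}^1_{b,T}$ is the set of $F:[0,T]\times C^\infty(\mathbb{T}^2)'\to\mathbb{R}$ of the form $F(t,\omega)=\sum_{i=1}^m\widetilde f_i(\langle\omega,\phi_1\rangle,\dots,\langle\omega,\phi_n\rangle)g_i(t)$ with $\phi_1,\dots,\phi_n\in C^\infty(\mathbb{T}^2)$, $\widetilde f_i\in C^1_b(\mathbb{R}^n)$, $g_i\in C^1([0,T])$, $g_i(T)=0$. For such $F$, $$\langle D_\omega F(t,\omega),b(\omega)\rangle:=\sum_{i=1}^m\sum_{j=1}^n\partial_j\widetilde f_i(\langle\omega,\phi_1\rangle,\dots,\langle\omega,\phi_n\rangle)\,g_i(t)\,\langle\omega\otimes\omega,H_{\phi_j}\rangle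 .$$ Bounded weak solution: a bounded measurable $\rho:[0,T]\times H^{-1-}(\mathbb{T}^2)\to[0,\infty)$ is a bounded weak solution of $\partial_t\rho_t+\operatorname{div}_\mu(\rho_tb)=0$ with initial condition $\rho_0$ if, for all $F\in\mathcal{FC}^1_{b,T}$, $$\int_0^T\int\left(\partial_tF(t,\omega)+\langle D_\omega F(t,\omega),b(\omega)\rangle\right)\rho_t(\omega)\,\mu(d\omega)\,dt=-\int F(0,\omega)\rho_0(\omega)\,\mu(d\omega),$$ the integrals in $\omega$ being over $H^{-1-}(\mathbb{T}^2)$ (which has full $\mu$-measure). *)

(* Defs.v *)
From HB Require Import structures.
From mathcomp Require Import all_boot all_order all_algebra.
From mathcomp Require Import finmap ring lra.
From mathcomp Require Import all_classical all_reals all_analysis.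
Set Implicit Arguments.
Unset Strict Implicit.
Unset Printing Implicit Defensive.
Import Order.TTheory GRing.Theory Num.Theory.
Import numFieldNormedType.Exports.
Local Open Scope classical_set_scope.
Local Open Scope ring_scope.

Section Torus.
Context {R : realType}.
Implicit Types (p q : R * R) (f : R * R -> R).

(* A function on the torus R^2/Z^2 is a Z^2-periodic function on R * R, and a
   point of the torus is given by any of its lifts. Differentiation is in the
   first coordinate for false, in the second one for true. *)
Definition dir (b : bool) : R * R := if b then (0, 1) else (1, 0).
Definition pd (b : bool) f : R * R -> R := fun p => 'D_(dir b) f p.
Definition pds (s : seq bool) f : R * R -> R := foldr pd f s.

(* For D open: all iterated partial derivatives exist and are continuous on D. *)
Definition smooth_on (D : set (R * R)) f := forall s p, D p ->
  {for p, continuous (pds s f)} /\ forall b, derivable (pds s f) p (dir b).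

Definition lat (k : int * int) : R * R := (k.1%:~R, k.2%:~R).
Definition Zperiodic f := forall k, periodic f (lat k).

Definition is_test f := Zperiodic f /\ smooth_on setT f.
Definition test_pred : {pred (R * R -> R)} := mem [set f | is_test f].

Lemma pdsD (a : R) f g s : smooth_on setT f -> smooth_on setT g ->
  pds s (a *: f + g) = a *: pds s f + pds s g.
Proof.
move=> sf sg; elim: s => //= b s ->; apply/funext => p.
have df : derivable (a *: pds s f) p (dir b).
  by apply: derivableZ; exact: (sf s p I).2.
by rewrite {1}/pd deriveD// ?deriveZ//; [exact: (sf s p I).2|exact: (sg s p I).2].
Qed.

Lemma test_submod_closed : submod_closed test_pred.
Proof.
split=> [|a f g]; rewrite !inE.
  suff H s : pds s (0 : R * R -> R) = 0.
    split=> [//|s p _]; rewrite H; split=> [|b]; first exact: cst_continuous.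
    exact: derivable_cst.
  by elim: s => //= b s ->; apply/funext => p; rewrite /pd derive_cst.
move=> [pf sf] [pg sg]; split=> [k p|s p _].
  by rewrite !fctE pf pg.
rewrite pdsD//; split=> [|b].
  apply: continuousD; last exact: (sg s p I).1.
  by apply: continuousZr; exact: (sf s p I).1.
by apply: derivableD; [apply: derivableZ; exact: (sf s p I).2|exact: (sg s p I).2].
Qed.

HB.instance Definition _ :=
  GRing.isSubmodClosed.Build R (R * R -> R) test_pred test_submod_closed.

End Torus.
(* C^oo(T^2) *)
Record test (R : realType) := Test {
  test_fun :> R * R -> R;
  _ : test_fun \in @test_pred R }.

Section TestType.
Context {R : realType}.
HB.instance Definition _ := [isSub for @test_fun R].
HB.instance Definition _ := [Choice of test R by <:].
HB.instance Definition _ := [SubChoice_isSubLmodule of test R by <:].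

Definition phase (n : int * int) (p : R * R) : R :=
  2 * pi * (n.1%:~R * p.1 + n.2%:~R * p.2).

Definition trig (n : int * int) (a b : R) (p : R * R) : R :=
  a * cos (phase n p) + b * sin (phase n p).

Lemma is_derive_line (f : R * R -> R) p v d :
  is_derive (0 : R) (1 : R) (fun h => f (h *: v + p)) d -> is_derive p v f d.
Proof.
move=> [df <-].
have E : (fun h : R => h^-1 *: (((fun h => f (h *: v + p)) \o shift 0) (h *: 1)
    - f (0 *: v + p))) = (fun h => h^-1 *: ((f \o shift p) (h *: v) - f p)).
  apply/funext => h /=.
  by rewrite addr0 scale0r add0r [h *: (1 : R)]mulr1.
by constructor; rewrite /derivable /derive -E.
Qed.

Lemma derive_trig (n : int * int) (a b : R) (c : bool) p :
  let k := 2 * pi * (if c then n.2 else n.1)%:~R in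
  is_derive p (dir c) (trig n a b) (trig n (k * b) (- (k * a)) p).
Proof.
move=> k; apply: is_derive_line.
have -> : (fun h : R => trig n a b (h *: dir c + p)) =
    (fun h => a * cos (k * h + phase n p) + b * sin (k * h + phase n p)).
  apply/funext => h; rewrite /trig.
  suff -> : phase n (h *: dir c + p) = k * h + phase n p by [].
  by rewrite /phase /k /dir; case: c {k} => /=;
    rewrite /GRing.scale /= ?mulr0 ?mulr1 ?add0r; ring.
pose g (h : R) := k * h + phase n p.
have dg : is_derive (0 : R) (1 : R) g k.
  have -> : g = k \*: id + cst (phase n p) by apply/funext.
  by apply: is_derive_eq; rewrite addr0 [LHS]mulr1.
have g0 : g 0 = phase n p by rewrite /g mulr0 add0r.
have dc : is_derive (0 : R) (1 : R) (cos \o g) (- sin (phase n p) * k).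
  by rewrite -g0; exact: is_derive1_comp.
have ds : is_derive (0 : R) (1 : R) (sin \o g) (cos (phase n p) * k).
  by rewrite -g0; exact: is_derive1_comp.
have -> : (fun h => a * cos (k * h + phase n p) + b * sin (k * h + phase n p)) =
  a \*: (cos \o g) + b \*: (sin \o g) by apply/funext.
apply: is_derive_eq; rewrite /trig /GRing.scale /=; ring.
Qed.

Lemma continuous_trig n (a b : R) : continuous (trig n a b).
Proof.
move=> p.
have cp : {for p, continuous (phase n)}.
  apply: continuousM; first exact: cst_continuous.
  apply: continuousD; apply: continuousM; try exact: cst_continuous.
    exact: cvg_fst.
  exact: cvg_snd.
apply: cvgD; apply: cvgM; try exact: cvg_cst.
  by apply: continuous_comp => //; exact: continuous_cos.
by apply: continuous_comp => //; exact: continuous_sin.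
Qed.

Lemma trig_is_test n (a b : R) : trig n a b \in test_pred.
Proof.
rewrite inE; split=> [k p|].
  have E : phase n (p + lat k) =
      phase n p + (pi *+ 2) *~ (n.1 * k.1 + n.2 * k.2).
    rewrite /phase /= -[_ *~ (_ + _)]mulrzr -mulr_natl intrD !intrM; ring.
  rewrite /trig E; case: (n.1 * k.1 + n.2 * k.2) => m.
    by rewrite -pmulrn (periodicn (@cosD2pi R)) (periodicn (@sinD2pi R)).
  rewrite NegzE mulrNz -pmulrn.
  rewrite -(periodicn (@cosD2pi R) m.+1 (_ - _)).
  by rewrite -(periodicn (@sinD2pi R) m.+1 (_ - _)) subrK.
have H s : exists a' b', pds s (trig n a b) = trig n a' b'.
  elim: s => [|c s [a' [b' /= ->]]]; first by exists a, b.
  pose k : R := 2 * pi * (if c then n.2 else n.1)%:~R.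
  exists (k * b'), (- (k * a')); apply/funext => p.
  by rewrite /pd; have [_ ->] := derive_trig n a' b' c p.
move=> s p _; have [a' [b' ->]] := H s; split; first exact: continuous_trig.
by move=> c; have [] := derive_trig n a' b' c p.
Qed.

(* e_n = cosT n + i sinT n, so that |<w, e_n>|^2 = w (cosT n)^2 + w (sinT n)^2
   for a real distribution w. *)
Definition cosT n : test R := Test (trig_is_test n 1 0).
Definition sinT n : test R := Test (trig_is_test n 0 1).
End TestType.

Section Sobolev.
Context {R : realType}.
Implicit Types (u v : test R -> R) (s : R).

(* 1 + |n|^2 *)
Definition weight (n : int * int) : R := 1 + n.1%:~R ^+ 2 + n.2%:~R ^+ 2.

Definition sob_term s u n : R :=
  weight n `^ s * (u (cosT n) ^+ 2 + u (sinT n) ^+ 2).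
Definition sobsq s u : \bar R := \esum_(n in [set: int * int]) (sob_term s u n)%:E.
Definition sobnorm s u : \bar R := sqrte (sobsq s u).

Lemma sob_term_ge0 s u n : 0 <= sob_term s u n.
Proof. by rewrite mulr_ge0 ?powR_ge0 ?addr_ge0 ?sqr_ge0. Qed.

Lemma sobsq_ge0 s u : (0 <= sobsq s u)%E.
Proof. by apply: esum_ge0 => n _; rewrite lee_fin sob_term_ge0. Qed.

Lemma sobsq_add s u v (a b : R) : 0 < a -> 0 < b ->
  (sobsq s u <= (a ^+ 2)%:E)%E -> (sobsq s v <= (b ^+ 2)%:E)%E ->
  (sobsq s (u \+ v)%R <= ((a + b) ^+ 2)%:E)%E.
Proof.
move=> a0 b0 ua vb; apply: ge_ereal_sup => _ [X [finX _] <-].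
have bound w c : (sobsq s w <= c%:E)%E ->
    \sum_(n <- fset_set X) sob_term s w n <= c.
  move=> wc; rewrite -lee_fin; apply: le_trans wc; apply: esum_ge.
  by exists X => //; rewrite -fsbig_finite// fsumEFin.
rewrite fsumEFin// lee_fin fsbig_finite//=.
apply: (@le_trans _ _ (\sum_(n <- fset_set X)
    ((a + b) / a * sob_term s u n + (a + b) / b * sob_term s v n))).
  apply: ler_sum => n _.
  have K (x y : R) : (x + y) ^+ 2 <= (a + b) / a * x ^+ 2 + (a + b) / b * y ^+ 2.
    rewrite -subr_ge0 (_ : _ - _ = (b * x - a * y) ^+ 2 / (a * b)).
      by rewrite divr_ge0 ?sqr_ge0 ?mulr_ge0 ?ltW.
    by field; rewrite !gt_eqF.
  rewrite /sob_term; have := powR_ge0 (weight n) s.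
  move: (weight n `^ s) => w w0.
  have := K (u (cosT n)) (v (cosT n)); have := K (u (sinT n)) (v (sinT n)).
  move=> /(ler_wpM2l w0) h1 /(ler_wpM2l w0) h2.
  by rewrite mulrDr /=; lra.
rewrite big_split/= -!mulr_sumr.
apply: (@le_trans _ _ ((a + b) / a * a ^+ 2 + (a + b) / b * b ^+ 2)).
  by apply: lerD; apply: ler_wpM2l; rewrite ?bound// divr_ge0// ?addr_ge0// ltW.
rewrite le_eqVlt; apply/orP; left; apply/eqP; field; by rewrite !gt_eqF.
Qed.

Lemma sobnorm_ge0 s u : (0 <= sobnorm s u)%E.
Proof. exact: sqrte_ge0. Qed.

Lemma sobnorm_le s u (a : R) : 0 <= a ->
  (sobnorm s u <= a%:E)%E = (sobsq s u <= (a ^+ 2)%:E)%E.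
Proof.
move=> a0; rewrite -[RHS]lee_sqrt ?lee_fin ?sqr_ge0//.
by rewrite [X in _ = (_ <= X)%E]/= sqrtr_sqr ger0_norm.
Qed.

Lemma sobnorm_add s u v : (sobnorm s (u \+ v)%R <= sobnorm s u + sobnorm s v)%E.
Proof.
have := sobnorm_ge0 s v; have := sobnorm_ge0 s u.
case Eu : (sobnorm s u) => [a| |] // u0; last first.
  by move=> v0; rewrite addye ?leey// gt_eqF// (lt_le_trans _ v0)// ltNy0.
case Ev : (sobnorm s v) => [b| |] // v0; last by rewrite addey ?leey.
move: u0 v0; rewrite !lee_fin => a0 b0.
apply/lee_addgt0Pr => e e0; rewrite -!EFinD.
have e2 : 0 < e / 2 by rewrite divr_gt0.
have ae : 0 < a + e / 2 by rewrite ltr_wpDl.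
have be : 0 < b + e / 2 by rewrite ltr_wpDl.
rewrite (_ : a + b + e = (a + e / 2) + (b + e / 2)); last by field.
rewrite sobnorm_le; last by rewrite ltW// addr_gt0.
by apply: sobsq_add => //; rewrite -sobnorm_le ?(ltW ae) ?(ltW be)// ?Eu ?Ev
  ?lee_fin ?lerDl ?(ltW e2).
Qed.

Lemma sobnorm_opp s u v : sobnorm s (u \- v) = sobnorm s (v \- u).
Proof.
congr sqrte; apply: eq_esum => n _; rewrite /sob_term /=.
by rewrite -sqrrN opprB -[in X in _ + X]sqrrN opprB.
Qed.

Lemma sobnorm0 s u : u =1 (fun=> 0) -> sobnorm s u = 0%E.
Proof.
move=> u0; rewrite /sobnorm /sobsq esum1 ?sqrte0// => n _.
by rewrite /sob_term !u0 expr0n/= addr0 mulr0.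
Qed.

(* The distance of H^{-1-}. The index is shifted by one; since the norms take
   values in the extended reals, it makes sense for arbitrary functionals. *)
Definition dHm u v : \bar R :=
  (\sum_(0 <= n <oo)
    ((2^-1) ^+ n.+1)%:E * mine (sobnorm (- 1 - n.+1%:R^-1) (u \- v)%R) 1)%E.

Lemma dHm_ge0_term u v n : (0 <=
  ((2^-1) ^+ n.+1)%:E * mine (sobnorm (- 1 - n.+1%:R^-1) (u \- v)%R) 1)%E.
Proof.
by rewrite mule_ge0 ?lee_fin ?exprn_ge0 ?invr_ge0// le_min sobnorm_ge0 lee_fin ler01.
Qed.

Lemma dHmxx u : dHm u u = 0%E.
Proof.
apply: eseries0 => n _ _; rewrite sobnorm0 ?/mine ?lte_fin ?ltr01 ?mule0//.
by move=> f /=; rewrite subrr.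
Qed.

Lemma dHm_sym u v : dHm u v = dHm v u.
Proof. by apply: eq_eseriesr => n _; rewrite sobnorm_opp. Qed.

Lemma dHm_triangle v u w : (dHm u w <= dHm u v + dHm v w)%E.
Proof.
rewrite /dHm -nneseriesD; [|by move=> *; exact: dHm_ge0_term..].
apply: lee_nneseries => [n _ _|n _]; first exact: dHm_ge0_term.
rewrite -ge0_muleDr ?le_min ?sobnorm_ge0 ?lee_fin ?ler01//.
apply: lee_wpmul2l; first by rewrite lee_fin exprn_ge0 ?invr_ge0.
have -> : u \- w = (u \- v) \+ (v \- w).
  by apply/funext => f /=; rewrite addrA subrK.
have := sobnorm_add (- 1 - n.+1%:R^-1) (u \- v) (v \- w).
have := sobnorm_ge0 (- 1 - n.+1%:R^-1) (u \- v).
have := sobnorm_ge0 (- 1 - n.+1%:R^-1) (v \- w).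
move: (sobnorm _ _) (sobnorm _ (u \- v)) (sobnorm _ (v \- w)) => z x y y0 x0 zxy.
have [x1|x1] := leP x 1%E; last first.
  rewrite ge_min; apply/orP; right; rewrite leeDl// le_min y0 lee_fin ler01//.
have [y1|y1] := leP y 1%E; last first.
  by rewrite ge_min; apply/orP; right; rewrite leeDr.
by rewrite ge_min zxy.
Qed.

End Sobolev.

(* C^oo(T^2)': continuity is boundedness by a C^N norm. *)
Record distr (R : realType) := Distr {
  dist_fun :> {scalar test R};
  _ : exists (C : R) (N : nat), forall (phi : test R) (M : R),
    (forall s p, (size s <= N)%N -> `|pds s phi p| <= M) ->
    `|dist_fun phi| <= C * M }.

(* H^{-1-}(T^2), endowed below with the topology of dHm and its Borel
   sigma-algebra. *)
Record Hm (R : realType) := MkHm {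
  Hm_distr :> distr R;
  _ : forall e : R, 0 < e -> (sobsq (- 1 - e) Hm_distr < +oo)%E }.

Section HmTopology.
Context {R : realType}.

Lemma zero_dist_cont : exists (C : R) (N : nat), forall (phi : test R) (M : R),
  (forall s p, (size s <= N)%N -> `|pds s phi p| <= M) ->
  `|(\0 : {scalar test R}) phi| <= C * M.
Proof. by exists 0, 0%N => phi M _; rewrite normr0 mul0r. Qed.

Lemma zero_sob (e : R) : 0 < e -> (sobsq (- 1 - e) (Distr zero_dist_cont) < +oo)%E.
Proof.
move=> _; rewrite /sobsq esum1 ?ltey// => n _.
by rewrite /sob_term /= expr0n/= addr0 mulr0.
Qed.

HB.instance Definition _ := gen_eqMixin (Hm R).
HB.instance Definition _ := gen_choiceMixin (Hm R).
HB.instance Definition _ := isPointed.Build (Hm R) (MkHm zero_sob).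

Definition Hm_ball (x : Hm R) (e : R) : set (Hm R) := [set y | (dHm x y < e%:E)%E].

Lemma Hm_ball_center x (e : R) : 0 < e -> Hm_ball x e x.
Proof. by move=> e0; rewrite /Hm_ball /= dHmxx lte_fin. Qed.

Lemma Hm_ball_sym x y (e : R) : Hm_ball x e y -> Hm_ball y e x.
Proof. by rewrite /Hm_ball /= dHm_sym. Qed.

Lemma Hm_ball_triangle x y z (a b : R) :
  Hm_ball x a y -> Hm_ball y b z -> Hm_ball x (a + b) z.
Proof.
rewrite /Hm_ball /= => xy yz; apply: (le_lt_trans (dHm_triangle y x z)).
by rewrite EFinD lteD.
Qed.

HB.instance Definition _ := hasNbhs.Build (Hm R) (nbhs_ (entourage_ Hm_ball)).
HB.instance Definition _ := Nbhs_isPseudoMetric.Build R (Hm R)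
  erefl Hm_ball_center Hm_ball_sym Hm_ball_triangle erefl.

Definition borel_display : measure_display. Proof. exact: default_measure_display. Qed.
HB.instance Definition _ := @isMeasurable.Build borel_display (Hm R)
  (<<s @open (Hm R) >>) (@sigma_algebra0 _ _ _) (@sigma_algebraC _ _) (@sigma_algebra_bigcup _ _ _).

End HmTopology.

Section Functions.
Context {R : realType}.
Implicit Types (f h : R * R -> R * R -> R) (phi : test R) (G : R * R -> R).

(* Fundamental domain of the torus; integrals over the torus are over Q. *)
Definition Q : set (R * R) := `[0, 1] `*` `[0, 1].
Definition leb2 : {measure set (measurableTypeR R * measurableTypeR R)%type -> \bar R} :=
  (@lebesgue_measure R \x @lebesgue_measure R)%E.

(* The coefficient of f on e_k (x) e_l is fcos f k l - i fsin f k l. *)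
Definition fcos f (k l : int * int) : R := \int[leb2]_(x in Q) \int[leb2]_(y in Q)
  (f x y * cos (phase k x + phase l y)).
Definition fsin f (k l : int * int) : R := \int[leb2]_(x in Q) \int[leb2]_(y in Q)
  (f x y * sin (phase k x + phase l y)).

(* Since 2 + e exceeds half the dimension of T^2 x T^2, elements of H^{2+e} are
   continuous functions; the continuous representative is taken, so that values
   on the diagonal make sense. *)
Definition in_H2plus f :=
  [/\ continuous (fun z : (R * R) * (R * R) => f z.1 z.2),
      forall x, Zperiodic (f x), forall y, Zperiodic (f ^~ y) &
      exists2 e : R, 0 < e & (\esum_(k in [set: (int * int) * (int * int)])
        ((weight k.1 + weight k.2 - 1) `^ (2 + e) *
         (fcos f k.1 k.2 ^+ 2 + fsin f k.1 k.2 ^+ 2))%:E < +oo)%E].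

(* The square |k_1|, |k_2| <= N. *)
Definition zbox (N : nat) : seq (int * int) :=
  let r := [seq i%:Z - N%:Z | i <- iota 0 (2 * N).+1] in
  [seq (i, j) | i <- r, j <- r].

(* <w (x) w, f>: the duality of H^{-2-} and H^{2+}, where w (x) w is applied to the
   Fourier series of f, with
     <w (x) w, e_k (x) e_l> = <w, e_k> <w, e_l>.
   The summand is the real part of the (k, l) term; the imaginary parts cancel
   because f and w are real. For w in H^{-1-} and f in H^{2+} the series is
   absolutely convergent, so the shape of the partial sums is immaterial. *)
Definition pair2_term (w : Hm R) f (k l : int * int) : R :=
  fcos f k l * (w (cosT k) * w (cosT l) - w (sinT k) * w (sinT l)) +
  fsin f k l * (w (sinT k) * w (cosT l) + w (cosT k) * w (sinT l)).
Definition pair2 (w : Hm R) f : R :=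
  limn (fun N => \sum_(k <- zbox N) \sum_(l <- zbox N) pair2_term w f k l).

Definition laplacian (g : R * R -> R) p : R :=
  pds [:: false; false] g p + pds [:: true; true] g p.

(* G is the zero-mean solution of (Laplacian G) = delta_0 - 1 in the sense of
   distributions, smooth off the lattice. *)
Definition green G := [/\ Zperiodic G, smooth_on (~` range lat) G,
  leb2.-integrable Q (EFin \o G), \int[leb2]_(x in Q) G x = 0 &
  forall phi, \int[leb2]_(x in Q) (G x * laplacian phi x) =
              phi 0 - \int[leb2]_(x in Q) phi x].

Definition BS G (x : R * R) : R * R :=
  if x \in range lat then 0 else (pd true G x, - pd false G x).

Definition Hphi G phi (x y : R * R) : R := 2^-1 *
  ((BS G (x - y)).1 * (pd false phi x - pd false phi y) +
   (BS G (x - y)).2 * (pd true phi x - pd true phi y)).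

Definition admissible G phi (Hn : nat -> R * R -> R * R -> R) :=
  [/\ forall n, in_H2plus (Hn n),
      forall n x y, Hn n x y = Hn n y x,
      (fun n => \int[leb2]_(x in Q) \int[leb2]_(y in Q)
        ((Hn n x y - Hphi G phi x y) ^+ 2)%:E)%E @ \oo --> 0%E &
      (fun n => \int[leb2]_(x in Q) Hn n x x) @ \oo --> (0 : R)].

(* "The limit along any admissible sequence": nonemptiness of the class of
   admissible sequences is what makes such a limit unique. *)
Definition admissible_limit G phi (cv : (nat -> R * R -> R * R -> R) -> Prop) :=
  (exists Hn, admissible G phi Hn) /\ forall Hn, admissible G phi Hn -> cv Hn.

End Functions.

Section WhiteNoise.
Context {R : realType}.
Implicit Types (mu : probability (Hm R) R) (phi psi : test R) (G : R * R -> R).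

(* The degenerate Gaussian is treated apart because normal_prob 0 0 is, by
   convention, the uniform law on [0, 1] and not a Dirac mass. *)
Definition centered_gaussian mu (X : Hm R -> R) :=
  measurable_fun setT X /\
  ((forall A, measurable A -> mu (X @^-1` A) = \d_(0 : R) A) \/
   exists2 s : R, s != 0 &
     forall A, measurable A -> mu (X @^-1` A) = normal_prob 0 s A).

Definition white_noise_law mu :=
  (forall phi, centered_gaussian mu (fun w => w phi)) /\
  forall phi psi, (\int[mu]_w (w phi * w psi)%:E)%E =
                  (\int[leb2]_(x in Q) (phi x * psi x))%:E.

(* g is a version of the element w |-> <w (x) w, H_phi> of L^2(mu). *)
Definition Hpairing G mu phi (g : Hm R -> R) :=
  [/\ measurable_fun setT g, (\int[mu]_w ((g w) ^+ 2)%:E < +oo)%E &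
      admissible_limit G phi (fun Hn =>
        (fun n => \int[mu]_w ((pair2 w (Hn n) - g w) ^+ 2)%:E)%E @ \oo --> 0%E)].

Definition density_family (T : R) mu (rho : R -> Hm R -> R) :=
  exists C q : R, [/\ 0 < C, 1 < q & forall t, t \in `[0, T] ->
    [/\ measurable_fun setT (rho t), forall w, 0 <= rho t w,
        (\int[mu]_w (rho t w `^ q)%:E <= C%:E)%E &
        (\int[mu]_w (rho t w)%:E = 1)%E]].

Section Process.
Context (T : R) {d : measure_display} {Xi : measurableType d}
  (P : probability Xi R).
Implicit Types om : Xi -> R -> Hm R.

(* A is a version of the process s |-> <om_s (x) om_s, H_phi> in
   L^1(Xi; L^1(0, T)). *)
Definition nonlinear_process G om phi (A : Xi -> R -> R) :=
  (P \x @lebesgue_measure R)%E.-integrable (setT `*` `[0, T])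
    (fun z => (A z.1 z.2)%:E) /\
  admissible_limit G phi (fun Hn =>
    (fun n => \int[P]_x \int[lebesgue_measure]_(s in `[0%R, T])
      `|pair2 (om x s) (Hn n) - A x s|%:E)%E @ \oo --> 0%E).

(* Measurability of om as a map into C^oo(T^2)' is with respect to the
   sigma-algebra generated by the evaluations at test functions. Values of om
   outside [0, T] are irrelevant. *)
Definition white_noise_solution G mu (rho : R -> Hm R -> R) om :=
  [/\ density_family T mu rho,
      forall phi, measurable_fun (setT `*` `[0, T] : set (Xi * measurableTypeR R))
                    (fun z => om z.1 z.2 phi),
      forall x, {within `[0, T], continuous (om x)},
      forall t, t \in `[0, T] -> measurable_fun setT (om ^~ t) /\
        forall A, measurable A ->
          P ((om ^~ t) @^-1` A) = (\int[mu]_(w in A) (rho t w)%:E)%E &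
      forall phi,
        (forall x, {within `[0, T], continuous (fun t => om x t phi)}) /\
        exists2 A, nonlinear_process G om phi A &
          {ae P, forall x, forall t, t \in `[0, T] ->
            om x t phi = om x 0 phi + \int[lebesgue_measure]_(s in `[0, t]) A x s}].

(* X i x t is a lift of the position of the i-th vortex, so that "distinct" means
   distinct modulo Z^2. *)
Definition random_point_vortices G (w : Xi -> R -> Hm R) :=
  exists (N : nat) (xi : 'I_N -> Xi -> R) (X : 'I_N -> Xi -> R -> R * R),
  let c : R := (Num.sqrt N%:R)^-1 in
  [/\ (0 < N)%N,
      forall i, measurable_fun setT (xi i),
      forall i, measurable_fun setT (fun x => X i x 0 : measurableTypeR R * measurableTypeR R),
      forall t phi, t \in `[0, T] -> measurable_fun setT (fun x => w x t phi) /\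
        forall x, w x t phi = c * \sum_(i < N) xi i x * phi (X i x t) &
      {ae P, forall x,
        (forall i j t, t \in `[0, T] -> i != j ->
           ~ range lat (X i x t - X j x t)) /\
        (forall i, {within `[0, T], continuous (X i x)}) /\
        (forall i t, t \in `]0, T[ -> is_derive t 1 (X i x)
           (\sum_(j < N) (c * xi j x) *: BS G (X i x t - X j x t)))}].

Definition limit_of_vortices G om := exists wN : nat -> Xi -> R -> Hm R,
  (forall n, random_point_vortices G (wN n)) /\
  {ae P, forall x,
    (fun n => ereal_sup [set dHm (wN n x t) (om x t) | t in `[0, T]]) @ \oo --> 0%E}.

End Process.

Definition C1b n (f : 'rV[R]_n -> R) :=
  [/\ forall v, differentiable f v, exists M, forall v, `|f v| <= M &
      forall j, continuous ('D_(delta_mx 0 j) f) /\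
                exists M, forall v, `|'D_(delta_mx 0 j) f v| <= M].

(* C^1([0, T]): g^`() extends continuously from ]0, T[ to [0, T]. *)
Definition C1_itv (T : R) (g : R -> R) :=
  [/\ {within `[0, T], continuous g}, {in `]0, T[, forall t, derivable g t 1} &
      exists2 dg, {within `[0, T], continuous dg} & {in `]0, T[, g^`()%classic =1 dg}].

Record cylinder (T : R) := Cylinder {
  cyl_m : nat;
  cyl_n : nat;
  cyl_phi : 'I_cyl_n -> test R;
  cyl_f : 'I_cyl_m -> 'rV[R]_cyl_n -> R;
  cyl_g : 'I_cyl_m -> R -> R;
  _ : forall i, C1b (cyl_f i);
  _ : forall i, C1_itv T (cyl_g i);
  _ : forall i, cyl_g i T = 0 }.

Section Cylinder.
Context (T : R) (F : cylinder T).

Definition cyl_arg (w : Hm R) : 'rV[R]_(cyl_n F) := \row_j w (cyl_phi j).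

(* F(t, w) *)
Definition cyl_eval (t : R) (w : Hm R) : R :=
  \sum_(i < cyl_m F) cyl_f i (cyl_arg w) * cyl_g i t.

(* d_t F(t, w); the value of g^`() at t = 0 and t = T depends on g outside [0, T],
   but is only used under integrals in t. *)
Definition cyl_dt (t : R) (w : Hm R) : R :=
  \sum_(i < cyl_m F) cyl_f i (cyl_arg w) * (cyl_g i)^`()%classic t.

(* <D_w F(t, w), b(w)>, with B phi in the role of <w (x) w, H_phi>. *)
Definition cyl_drift (B : test R -> Hm R -> R) (t : R) (w : Hm R) : R :=
  \sum_(i < cyl_m F) \sum_(j < cyl_n F)
    'D_(delta_mx 0 j) (cyl_f i) (cyl_arg w) * cyl_g i t * B (cyl_phi j) w.
End Cylinder.

Definition bounded_weak_solution (T : R) mu (B : test R -> Hm R -> R)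
    (rho : R -> Hm R -> R) (rho0 : Hm R -> R) :=
  [/\ measurable_fun (`[0, T] `*` setT : set (measurableTypeR R * Hm R))
        (fun z => rho z.1 z.2),
      exists M : R, forall t w, t \in `[0, T] -> 0 <= rho t w <= M &
      forall F : cylinder T,
        (\int[lebesgue_measure]_(t in `[0%R, T]) \int[mu]_w
           ((cyl_dt F t w + cyl_drift F B t w) * rho t w)%:E)%E =
        (- \int[mu]_w (cyl_eval F 0 w * rho0 w)%:E)%E].

End WhiteNoise.

(* Main.v *)
Require Import Defs.
From mathcomp Require Import all_boot all_order all_algebra.
From mathcomp Require Import all_classical all_reals all_analysis.
From mathcomp Require Import ring measurable_realfun.
Import Order.TTheory GRing.Theory Num.Theory.
Import numFieldNormedType.Exports.
Local Open Scope classical_set_scope.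
Local Open Scope ring_scope.

(* Along almost every path, each t |-> <w_t, phi_j> is the primitive of an
   integrable function A_j, so t |-> F(t, w_t) obeys the chain rule for absolutely
   continuous functions; it vanishes at t = T, hence the time integral of its
   derivative is -F(0, w_0). Taking expectations, exchanging them with the time
   integral by Fubini, and replacing the law of w_t by rho_t mu at each fixed t
   gives the weak formulation, provided A_j(t) = <w_t (x) w_t, H_phi_j> almost
   surely for almost every t. The latter compares the L^1(Xi x [0, T]) limit defining
   A_j with the L^2(mu) limit defining H_phi_j, along a common admissible sequence;
   it is where the boundedness of rho is used. *)

(** * Measurability of compositions and of pointwise limits *)

Lemma measurable_row_comp d (X : measurableType d) (R : realType) (D : set X) n
    (f : 'rV[R]_n -> R) (u : 'I_n -> X -> R) : measurable D ->
  continuous f -> (forall j, measurable_fun D (u j)) ->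
  measurable_fun D (fun x => f (\row_j u j x)).
Proof.
move=> mD cf mu; apply: (measurability _ (RGenOInfty.measurableE R)) => //.
move=> _ [_ [a ->] <-].
(* The open set where [f] exceeds [a] is the union of the countably many sup-norm balls with
   rational centre and radius that it contains; the preimage of such a ball is a finite intersection
   of coordinate conditions. *)
pose rowr (q : 'rV[rat]_n) : 'rV[R]_n := \row_j ratr (q 0 j).
pose box (q : 'rV[rat]_n) (r : rat) : set X :=
  \bigcap_(j in [set: 'I_n]) (D `&` u j @^-1` ball (ratr (q 0 j) : R) (ratr r)).
pose good (z : 'rV[rat]_n * rat) := 0 < z.2 /\
  ball (rowr z.1) (ratr z.2) `<=` f @^-1` `]a, +oo[%classic.
(* The outer [D] matters on the right: for [n = 0] every [box] is the whole space. *)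
have -> : D `&` (fun x => f (\row_j u j x)) @^-1` `]a, +oo[ =
    D `&` \bigcup_(z in good) box z.1 z.2.
  apply/seteqP; split=> x [Dx /= H]; split => //.
    have /nbhs_ballP[e /= e0 He] : nbhs (\row_j u j x) (f @^-1` `]a, +oo[%classic).
      apply: cf; apply: open_nbhs_nbhs; split; first exact: interval_open.
      exact: H.
    (* A rational centre within [r < e / 2] of the point has its ball of radius [r] inside the ball
       of radius [e] about the point. *)
    have e2 : 0 < e / 2 by rewrite divr_gt0.
    have [r] := rat_in_itvoo e2; rewrite inE => /andP[]; rewrite !bnd_simp => r0 re.
    have /choice[q qP] (j : 'I_n) : exists q : rat, ball (u j x) (ratr r) (ratr q).
      have [z [Bz [q _ qz]]] := @dense_rat R (ball (u j x) (ratr r))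
        (ex_intro _ (u j x) (ballxx (u j x) r0)) (ball_open _ _).
      by exists q; rewrite qz.
    exists (\row_j q j, r); last first.
      by move=> j _; split => //=; rewrite mxE; apply: ball_sym; exact: qP.
    split=> /=; first by rewrite -(ltr0q R).
    move=> v Hv; apply: He; rewrite [e]splitr.
    apply: (@ball_triangle _ _ (rowr (\row_j q j))).
      split=> // i j; rewrite ord1 !mxE; apply: le_ball (qP j).
      exact: ltW.
    by apply: le_ball Hv; exact: ltW.
  case: H => -[q r] /= [r0 sub] Hb; apply: sub; split; first by rewrite ltr0q.
  by move=> i j; rewrite ord1 !mxE; have [] := Hb j I.
rewrite bigcup_mkcond; apply: measurableI => //.
apply: countable_bigcupT_measurable => // z.
case: ifP => _; last exact: measurable0.
apply: fin_bigcap_measurable => [|j _]; first exact: finite_finset.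
by apply: mu => //; exact: measurable_ball.
Qed.

(** The sequence may diverge at some points, where [limn] takes the default value [point]. The
    convergence set is where the upper and lower limits agree and are finite, hence measurable, and
    on it [limn] is their common value. *)
Lemma measurable_limn d (X : measurableType d) (R : realType) (D : set X)
    (u : nat -> X -> R) : measurable D ->
  (forall n, measurable_fun D (u n)) ->
  measurable_fun D (fun x => limn (u ^~ x)).
Proof.
move=> mD mu.
pose e n x : \bar R := (u n x)%:E.
pose hi x := limn_esup (e ^~ x); pose lo x := limn_einf (e ^~ x).
have me n : measurable_fun D (e n) by exact/measurable_EFinP.
have mhi : measurable_fun D hi by exact: measurable_fun_limn_esup.
have mlo : measurable_fun D lo.
  rewrite (_ : lo = fun x => - limn_esup ((fun n x => - e n x) ^~ x))%E.
    apply: measurableT_comp => //; apply: measurable_fun_limn_esup => n.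
    by apply: measurableT_comp => //; exact: me.
  apply/funext => x; rewrite -[RHS]/(- limn_esup (-%E \o (e ^~ x)))%E.
  by rewrite limn_esupN oppeK.
have cvgE x : cvgn (u ^~ x) <-> (hi x \is a fin_num /\ hi x = lo x).
  split=> [/cvg_ex[l ul]|[hf hl]].
    have el : e ^~ x @ \oo --> l%:E by apply: cvg_EFin => //; exact: nearW.
    by have [h1 h2] := cvg_limn_einf_sup el; rewrite /hi /lo h1 h2.
  have h1 : esups (e ^~ x) @ \oo --> hi x.
    by rewrite /hi limn_esup_lim; exact: is_cvg_esups.
  have h2 : einfs (e ^~ x) @ \oo --> hi x.
    by rewrite hl /lo limn_einf_lim; exact: is_cvg_einfs.
  have h3 : e ^~ x @ \oo --> hi x.
    apply: squeeze_cvge h2 h1; apply: nearW => n; apply/andP; split.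
      by apply: ereal_inf_lbound; exists n => //=.
    by apply: ereal_sup_ubound; exists n => //=.
  apply/cvg_ex; exists (fine (hi x)).
  by apply: (@fine_cvg _ _ _ _ (e ^~ x)); rewrite fineK.
pose f x : R := if (hi x \is a fin_num) && (hi x == lo x) then fine (hi x) else point.
have -> : (fun x => limn (u ^~ x)) = f.
  apply/funext => x; rewrite /f; case: ifPn => [/andP[hf /eqP hl]|h].
    have /cvg_ex[l ul] : cvgn (u ^~ x) by apply/cvgE.
    have el : e ^~ x @ \oo --> l%:E by apply: cvg_EFin => //; exact: nearW.
    have [_ h2] := cvg_limn_einf_sup el.
    rewrite /hi h2 /=; exact/cvg_lim.
  apply: dvgP; apply: contraNnot h => /cvgE[-> ->]; exact: eqxx.
apply: measurable_fun_if => //.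
- apply: measurable_and; first by apply: (measurable_fun_bool true);
    exact: emeasurable_fin_num.
  exact: measurable_fun_eqe.
by apply: measurableT_comp => //; exact: measurable_funS mhi.
Qed.

(** * Expectations under a law with a density *)

Section ChangeOfLaw.
Context d (X : measurableType d) d' (Y : measurableType d') (R : realType).
Variables (P : probability X R) (mu : probability Y R) (r : Y -> R) (Z : X -> Y).
Hypotheses (mr : measurable_fun setT r) (r0 : forall y, 0 <= r y)
  (mZ : measurable_fun setT Z)
  (law : forall A, measurable A -> P (Z @^-1` A) = (\int[mu]_(y in A) (r y)%:E)%E).
Import HBNNSimple.

Let mer : measurable_fun setT (fun y => (r y)%:E). Proof. exact/measurable_EFinP. Qed.

(** The two sides agree on indicators by [law], then on simple functions by linearity, and both pass
    to increasing limits because [r] is nonnegative. *)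
Lemma ge0_integral_law (f : Y -> \bar R) : measurable_fun setT f ->
  (forall y, 0 <= f y)%E ->
  (\int[P]_x f (Z x) = \int[mu]_y (f y * (r y)%:E))%E.
Proof.
move=> mf f0; pose g := nnsfun_approx measurableT mf.
have step (h : {nnsfun Y >-> R}) :
    (\int[P]_x (h (Z x))%:E = \int[mu]_y ((h y)%:E * (r y)%:E))%E.
  have hE y : h y = \sum_(c \in range h) c * \1_(h @^-1` [set c]) y by rewrite -fimfunE.
  under eq_integral do rewrite hE -fsumEFin//.
  rewrite [RHS](eq_integral (fun y =>
      \sum_(c \in range h) ((c * \1_(h @^-1` [set c]) y)%:E * (r y)%:E)))%E; last first.
    move=> y _; rewrite hE -fsumEFin// ge0_mule_fsuml// => c.
    exact: nnfun_muleindic_ge0.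
  rewrite ge0_integral_fsum//; last 2 first.
  - move=> c; apply/measurable_EFinP; apply: measurable_funM => //.
    exact: (measurableT_comp _ mZ).
  - by move=> c x _; exact: nnfun_muleindic_ge0.
  rewrite ge0_integral_fsum//; last 2 first.
  - move=> c; apply: emeasurable_funM => //.
    by apply/measurable_EFinP; apply: measurable_funM.
  - by move=> c x _; rewrite mule_ge0 ?lee_fin//; exact: nnfun_muleindic_ge0.
  apply: eq_fsbigr => c _.
  (* Pulling a level out of a nonnegative integral requires [0 <= c]; a negative level is never
     attained by [h], so both sides vanish there. *)
  have [c0|c0] := leP 0 c; last first.
    have h0 y : \1_(h @^-1` [set c]) y = 0 :> R.
      rewrite indicE memNset//= => hc; have : 0 <= h y by exact: fun_ge0.
      by rewrite hc leNgt c0.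
    by rewrite !integral0_eq// => y _; rewrite h0 mulr0 ?mul0e.
  under eq_integral do rewrite EFinM.
  rewrite ge0_integralZl//; last first.
    by apply/measurable_EFinP; exact: (measurableT_comp _ mZ).
  under [RHS]eq_integral do rewrite EFinM -muleA.
  rewrite ge0_integralZl//; last 2 first.
  - by apply: emeasurable_funM => //; apply/measurable_EFinP.
  - by move=> x _; rewrite mule_ge0 ?lee_fin.
  congr (_ * _)%E.
  have mA : measurable (h @^-1` [set c]) by [].
  transitivity (P (Z @^-1` (h @^-1` [set c]))).
    rewrite -[LHS]/(\int[P]_x (\1_(Z @^-1` (h @^-1` [set c])) x)%:E)%E.
    rewrite integral_indic ?setIT//.
    by rewrite -[X in measurable X]setTI; exact: mZ.
  rewrite law// [LHS]integral_mkcond; apply: eq_integral => y _.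
  by rewrite patchE indicE; case: ifP; rewrite ?mul1e ?mul0e.
transitivity (limn (fun n => \int[P]_x ((g n (Z x))%:E)))%E.
  rewrite -monotone_convergence//; last 3 first.
  - by move=> n; apply/measurable_EFinP; exact: (measurableT_comp _ mZ).
  - by move=> n x _; rewrite lee_fin.
  - by move=> x _ a b ab; rewrite lee_fin; exact/lefP/nd_nnsfun_approx.
  by apply: eq_integral => x _; apply/esym/cvg_lim => //; exact: cvg_nnsfun_approx.
under eq_fun do rewrite step.
rewrite -monotone_convergence//; last 3 first.
- by move=> n; apply: emeasurable_funM => //; apply/measurable_EFinP.
- by move=> n x _; rewrite mule_ge0 ?lee_fin.
- move=> x _ a b ab; rewrite lee_wpmul2r ?lee_fin//; exact/lefP/nd_nnsfun_approx.
apply: eq_integral => y _; apply/cvg_lim => //; apply: cvgeZr => //.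
exact: cvg_nnsfun_approx.
Qed.

(** Multiplication by [r >= 0] commutes with positive and negative parts, so each part falls under
    the nonnegative case. The two sides are then the same difference of extended reals, finite or
    not. *)
Lemma integral_law (f : Y -> R) : measurable_fun setT f ->
  (\int[P]_x (f (Z x))%:E = \int[mu]_y (f y * r y)%:E)%E.
Proof.
move=> mf; have mef : measurable_fun setT (EFin \o f) by exact/measurable_EFinP.
rewrite integralE [RHS]integralE; congr (_ - _)%E.
  transitivity (\int[P]_x ((EFin \o f)^\+ (Z x)))%E.
    by apply: eq_integral => x _; rewrite !funeposE.
  rewrite ge0_integral_law; [|exact: measurable_funepos|by []].
  apply: eq_integral => y _.
  by rewrite !funeposE /= EFinM maxe_pMl ?lee_fin// mul0e.
transitivity (\int[P]_x ((EFin \o f)^\- (Z x)))%E.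
    by apply: eq_integral => x _; rewrite !funenegE.
rewrite ge0_integral_law; [|exact: measurable_funeneg|by []].
apply: eq_integral => y _.
by rewrite !funenegE /= maxe_pMl ?lee_fin// mul0e -EFinM mulNr.
Qed.
End ChangeOfLaw.

(** * Chain rule along absolutely continuous paths *)

Lemma cvg_row (R : realType) (I : Type) (F : set_system I) {FF : Filter F} n
    (u : 'I_n -> I -> R) (l : 'I_n -> R) :
  (forall j, u j x @[x --> F] --> l j) ->
  (\row_j u j x) @[x --> F] --> \row_j l j.
Proof.
move=> ul; apply/cvgrPdist_le => /= e e0.
near=> x; rewrite /Num.Def.normr/= mx_normrE (bigmax_le _ (ltW e0))//= => ij _.
rewrite !mxE; move: ij; near: x; apply: filter_forall => -[i j].
exact: ((cvgrPdist_le _ _).1 (ul j)).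
Unshelve. all: by end_near. Qed.

Lemma C1b_bound (R : realType) n (f : 'rV[R]_n -> R) : C1b f ->
  exists M, [/\ 0 <= M, forall v, `|f v| <= M &
    forall j v, `|'D_(delta_mx 0 j) f v| <= M].
Proof.
move=> [_ [M fM] Df].
have /choice[N DN] j : exists M, forall v, `|'D_(delta_mx 0 j) f v| <= M.
  by have [] := Df j.
exists (M + \sum_j `|N j|); split=> [|v|j v].
- by rewrite addr_ge0 ?sumr_ge0// (le_trans _ (fM 0)).
- by rewrite (le_trans (fM v))// lerDl sumr_ge0.
rewrite (le_trans (DN j v))// (le_trans (ler_norm _))//.
rewrite (bigD1 j)//= addrCA lerDl addr_ge0 ?sumr_ge0//.
by rewrite (le_trans _ (fM 0)).
Qed.

Lemma C1b_continuous (R : realType) n (f : 'rV[R]_n -> R) : C1b f -> continuous f.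
Proof. by move=> [df _ _] v; exact: differentiable_continuous. Qed.

Lemma within_continuous_itv_bound (R : realType) (a b : R) (g : R -> R) : a <= b ->
  {within `[a, b], continuous g} ->
  exists M, 0 <= M /\ forall t, t \in `[a, b] -> `|g t| <= M.
Proof.
move=> ab cg.
have /compact_bounded[M [_ HM]] := continuous_compact cg (@segment_compact _ a b).
exists (`|M| + 1); split; first by rewrite addr_ge0.
move=> t tab; apply: HM; last by exists t.
by rewrite (le_lt_trans (ler_norm M))// ltrDl.
Qed.

(** Inside the interval the derivative agrees with a function continuous on the closed interval. At
    0 and [T] its value depends on [g] outside the interval, so these two points are split off and
    contribute their own constants [g0] and [gT]. *)
Lemma C1_itv_derive_bound (R : realType) (T : R) (g : R -> R) : 0 < T -> C1_itv T g ->
  measurable_fun `[0, T] g^`()%classic /\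
  exists M, 0 <= M /\ forall t, t \in `[0, T] -> `|g^`()%classic t| <= M.
Proof.
move=> T0 [_ _ [h ch gh]]; split.
  rewrite -(@setU1itv _ _ (BRight T) 0 false) ?bnd_simp ?(ltW T0)//.
  rewrite -(@setUitv1 _ _ (BRight 0) T true) ?bnd_simp//.
  apply/measurable_funU => //; first exact: measurableU.
  split; first exact: measurable_fun_set1.
  apply/measurable_funU => //; split; last exact: measurable_fun_set1.
  apply: (@eq_measurable_fun _ _ _ _ _ h).
    by move=> t; rewrite inE => tT; rewrite gh.
  apply: (@measurable_funS _ _ _ _ `[0, T]%classic) => //.
    exact: subset_itv_oo_cc.
  exact: subspace_continuous_measurable_fun.
have [M [M0 hM]] := within_continuous_itv_bound _ _ _ _ (ltW T0) ch.
pose g0 := `|g^`()%classic 0|; pose gT := `|g^`()%classic T|.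
have [g00 gT0] : 0 <= g0 /\ 0 <= gT by split; exact: normr_ge0.
exists (M + g0 + gT); split; first by rewrite ?addr_ge0.
move=> t; rewrite in_itv /= => /andP[].
rewrite le_eqVlt => /predU1P[<- _|t0].
  by rewrite -/g0 -addrA addrCA lerDl addr_ge0.
rewrite le_eqVlt => /predU1P[->|tT].
  by rewrite -/gT lerDr addr_ge0.
rewrite gh ?in_itv /= ?t0//; apply: (le_trans (hM t _)).
  by rewrite in_itv /= !ltW.
by rewrite -addrA lerDl addr_ge0.
Qed.

Lemma derive_row_comp (R : realType) n (f : 'rV[R]_n -> R) (u : 'I_n -> R -> R) t :
  differentiable f (\row_j u j t) -> (forall j, derivable (u j) t 1) ->
  is_derive t 1 (fun s => f (\row_j u j s))
    (\sum_j 'D_(delta_mx 0 j) f (\row_j u j t) * (u j)^`()%classic t).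
Proof.
move=> df du; pose v s := \row_j u j s.
have dv : derivable v t 1.
  apply/derivable_mxP => i j.
  by rewrite (_ : (fun _ => _) = u j)//; apply/funext => s; rewrite /v mxE.
have dv' : differentiable v t by exact/derivable1_diffP.
have E : 'D_1 (f \o v) t = \sum_j 'D_(delta_mx 0 j) f (v t) * (u j)^`()%classic t.
  rewrite deriveE; last exact: differentiable_comp.
  rewrite diff_comp//= -(deriveE _ dv') derive_mx//.
  rewrite [X in 'd f _ X]matrix_sum_delta big_ord1 linear_sum.
  apply: eq_bigr => j _; rewrite linearZ /= mxE -deriveE//.
  rewrite (_ : (fun _ => _) = u j) ?derive1E 1?mulrC//.
  by apply/funext => s; rewrite /v mxE.
split=> //.
by apply: diff_derivable; exact: differentiable_comp.
Qed.

Lemma within_continuous_comp_row (R : realType) n (f : 'rV[R]_n -> R) (A : set R)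
    (u : 'I_n -> R -> R) : continuous f ->
  (forall j, {within A, continuous (u j)}) ->
  {within A, continuous (fun t => f (\row_j u j t))}.
Proof.
move=> cf cu t; apply: (@cvg_comp _ _ _ (fun t => \row_j u j t) f); last exact: cf.
by apply: (cvg_row _ _ (nbhs (t : subspace A))) => j; exact: cu.
Qed.

Lemma primitive_within_continuous (R : realType) (T c : R) (a : R -> R) : 0 < T ->
  lebesgue_measure.-integrable `[0, T] (EFin \o a) ->
  {within `[0, T], continuous (fun t => c + \int[lebesgue_measure]_(s in `[0, t]) a s)}.
Proof.
move=> T0 ia t; apply: cvgD; first exact: cvg_cst.
exact: (parameterized_integral_continuous (ltW T0) ia).
Qed.

(** For continuous [a j] the coordinates of [u] are differentiable on ]0, T[ with derivatives [a j],
    so the fundamental theorem of calculus applies to the product of [f (u t)] and [g t]. *)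
Lemma continuous_chain_rule (R : realType) (T : R) n (f : 'rV[R]_n -> R) (g : R -> R)
    (c : 'I_n -> R) (a : 'I_n -> R -> R) : 0 < T ->
  C1b f -> C1_itv T g -> (forall j, continuous (a j)) ->
  let u t := \row_j (c j + \int[lebesgue_measure]_(s in `[0, t]) a j s) in
  (\int[lebesgue_measure]_(t in `[0%R, T]) (f (u t) * g^`()%classic t +
     \sum_j 'D_(delta_mx 0 j) f (u t) * g t * a j t)%:E =
   (f (u T) * g T - f (u 0) * g 0)%:E)%E.
Proof.
move=> T0 f1 g1 ca u.
have cf := C1b_continuous _ _ _ f1.
have [df _ Df] := f1; have [cg dg [h ch gh]] := g1.
have [mg' _] := C1_itv_derive_bound _ _ _ T0 g1.
pose U j t := c j + \int[lebesgue_measure]_(s in `[0, t]) a j s.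
have ia j : lebesgue_measure.-integrable `[0, T] (EFin \o a j).
  apply: continuous_compact_integrable; first exact: segment_compact.
  exact: continuous_subspaceT.
have cU j : {within `[0, T], continuous (U j)} by exact: primitive_within_continuous.
have dU j t : t \in `]0, T[ -> derivable (U j) t 1 /\ (U j)^`()%classic t = a j t.
  rewrite in_itv /= => /andP[t0 tT].
  have [d1 d2] := continuous_FTC1_closed tT (ia j) t0 (ca j t).
  split; first by apply: derivableD; [exact: derivable_cst|exact: d1].
  rewrite derive1E deriveD; [|exact: derivable_cst|exact: d1].
  by rewrite derive_cst add0r -derive1E.
have cDf j : {within `[0, T], continuous (fun t => 'D_(delta_mx 0 j) f (u t))}.
  apply: (within_continuous_comp_row _ _ ('D_(delta_mx 0 j) f) _ U) => //.
  by have [] := Df j.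
have cfu : {within `[0, T], continuous (fun t => f (u t))}.
  exact: (within_continuous_comp_row _ _ f _ U).
pose F t := f (u t) * g t.
(* With the continuous extension [h] in place of the derivative of [g], the integrand is continuous
   up to the endpoints, as the fundamental theorem requires; the original one can differ from it
   only at 0 and [T]. *)
pose psi t := f (u t) * h t + \sum_j 'D_(delta_mx 0 j) f (u t) * g t * a j t.
have cS : {within `[0, T], continuous
    (fun t => \sum_j 'D_(delta_mx 0 j) f (u t) * g t * a j t)}.
  apply: (@continuous_big _ _ _ _ _ add_continuous (subspace `[0, T])) => j _ t.
  apply: cvgM.
    by apply: cvgM; [exact: cDf|exact: cg].
  exact: (continuous_subspaceT (ca j)).
have cpsi : {within `[0, T], continuous psi}.
  move=> t; apply: cvgD; last exact: cS.
  by apply: cvgM; [exact: cfu|exact: ch].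
have cF : {within `[0, T], continuous F}.
  by move=> t; apply: cvgM; [exact: cfu|exact: cg].
have dF t : t \in `]0, T[ -> is_derive t 1 F (psi t).
  move=> tT.
  have dfu := derive_row_comp _ _ f U t (df _) (fun j => (dU j t tT).1).
  have dgt : is_derive t 1 g (h t).
    by split; [exact: dg|rewrite -derive1E gh].
  have -> : psi t = f (u t) *: h t +
      g t *: \sum_j 'D_(delta_mx 0 j) f (u t) * (U j)^`()%classic t.
    rewrite /psi; congr (_ + _); rewrite /GRing.scale /= mulr_sumr.
    by apply: eq_bigr => j _; rewrite (dU j t tT).2; ring.
  exact: is_deriveM.
have LR : derivable_oo_LRcontinuous F 0 T.
  have [_ c0 cT] := (continuous_within_itvP F T0).1 cF.
  by split; [move=> t tT; have [] := dF t tT|exact: c0|exact: cT].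
have <- : (\int[lebesgue_measure]_(t in `[0%R, T]) (psi t)%:E)%E =
    (f (u T) * g T - f (u 0) * g 0)%:E.
  rewrite (@continuous_FTC2 _ psi F)// => t tT.
  by rewrite derive1E; have [] := dF t tT.
have m01 (k : R -> R) : measurable_fun `[0, T] k ->
    measurable_fun `]0, T[ (fun t => (k t)%:E).
  move=> mk; apply/measurable_EFinP; apply: measurable_funS mk => //.
  exact: subset_itv_oo_cc.
rewrite [LHS]integral_itv_bndoo; last first.
  apply: m01; apply: measurable_funD.
    by apply: measurable_funM => //; exact: subspace_continuous_measurable_fun.
  exact: subspace_continuous_measurable_fun.
rewrite [RHS]integral_itv_bndoo; last first.
  by apply: m01; exact: subspace_continuous_measurable_fun.
by apply: eq_integral => t; rewrite inE => tT; rewrite /psi gh.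
Qed.

(* The a_j are approximated in L^1 by continuous functions, for which the formula
   is the fundamental theorem of calculus. *)
Lemma integrable_chain_rule (R : realType) (T : R) n (f : 'rV[R]_n -> R) (g : R -> R)
    (c : 'I_n -> R) (a : 'I_n -> R -> R) : 0 < T ->
  C1b f -> C1_itv T g ->
  (forall j, lebesgue_measure.-integrable `[0, T] (EFin \o a j)) ->
  let u t := \row_j (c j + \int[lebesgue_measure]_(s in `[0, t]) a j s) in
  let phi t := f (u t) * g^`()%classic t +
     \sum_j 'D_(delta_mx 0 j) f (u t) * g t * a j t in
  lebesgue_measure.-integrable `[0, T] (EFin \o phi) /\
  (\int[lebesgue_measure]_(t in `[0%R, T]) (phi t)%:E =
   (f (u T) * g T - f (u 0) * g 0)%:E)%E.
Proof.
move=> T0 f1 g1 ia u phi.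
have cf := C1b_continuous _ _ _ f1; have [_ _ Df] := f1.
have [cg _ _] := g1.
have [M [M0 fM DfM]] := C1b_bound _ _ _ f1.
have [N [N0 gN]] := within_continuous_itv_bound _ _ _ _ (ltW T0) cg.
have [mg' [N' [N'0 g'N]]] := C1_itv_derive_bound _ _ _ T0 g1.
have mg : measurable_fun `[0, T] g by exact: subspace_continuous_measurable_fun.
have ma j : measurable_fun `[0, T] (a j).
  by apply/measurable_EFinP; exact: (measurable_int lebesgue_measure (ia j)).
have finT : (lebesgue_measure (`[0%R, T]%classic : set R) < +oo)%E.
  by rewrite lebesgue_measure_itv /= lte_fin T0 sube0 ltry.
have /choice[b bP] j := approximation_continuous_integrable
  (measurable_itv `[0, T]) finT (ia j).
pose uk k t := \row_j (c j + \int[lebesgue_measure]_(s in `[0, t]) b j k s).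
(* [psik k] is the integrand to which the continuous case applies. [phik k] follows the same
   approximate path but keeps the limits [a j] as factors, so that one integrable function [G]
   dominates it for all [k]. *)
pose phik k t := f (uk k t) * g^`()%classic t +
     \sum_j 'D_(delta_mx 0 j) f (uk k t) * g t * a j t.
pose psik k t := f (uk k t) * g^`()%classic t +
     \sum_j 'D_(delta_mx 0 j) f (uk k t) * g t * b j k t.
pose dist j k := (\int[lebesgue_measure]_(t in `[0%R, T]) `|(a j t - b j k t)%:E|)%E.
have cb j k : continuous (b j k) by have [] := bP j.
have ib j k : lebesgue_measure.-integrable `[0, T] (EFin \o b j k) by have [] := bP j.
have dist0 j : dist j k @[k --> \oo] --> 0%E by have [] := bP j.
have iab j k : lebesgue_measure.-integrable `[0, T] (fun t => (a j t - b j k t)%:E).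
  rewrite (_ : (fun t => _) = ((EFin \o a j) \- (EFin \o b j k))%E)//.
  by apply: integrableB; [exact: measurable_itv|exact: ia|exact: ib].
(* The primitives at [t] differ by at most the L^1 distance [dist j k] over the whole of [0, T]. *)
have cvgu t : t \in `[0, T] -> uk k t @[k --> \oo] --> u t.
  move=> tT; apply: cvg_row => j; apply: cvgD; first exact: cvg_cst.
  have sub : `[0, t] `<=` `[0, T].
    by apply: subset_itvl; rewrite bnd_simp; move: tT; rewrite in_itv => /andP[].
  have ia' : lebesgue_measure.-integrable `[0, t] (EFin \o a j).
    exact: integrableS (ia j).
  have ib' k : lebesgue_measure.-integrable `[0, t] (EFin \o b j k).
    exact: integrableS (ib j k).
  have d0 : fine (dist j k) @[k --> \oo] --> 0 by exact: fine_cvg (dist0 j).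
  apply/cvgrPdist_le => e e0; near=> k.
  rewrite -RintegralB;
    [|exact: measurable_itv|exact: ia'|exact: ib'].
  have iab' : lebesgue_measure.-integrable `[0, t] (fun s => (a j s - b j k s)%:E).
    exact: integrableS (iab j k).
  apply: le_trans (le_normr_Rintegral _ iab') _; first exact: measurable_itv.
  have dfin : dist j k \is a fin_num.
    rewrite ge0_fin_numE; last by apply: integral_ge0 => s _.
    by have /integrableP[] := iab j k.
  have : fine (dist j k) <= e.
    by near: k; apply: (cvgr_le _ d0).
  have mab : measurable_fun `[0, T] (fun s => `|(a j s - b j k s)%:E|%E).
    by apply: measurableT_comp => //; exact: (measurable_int _ (iab j k)).
  have le2 :
      (\int[lebesgue_measure]_(s in `[0%R, t]) `|(a j s - b j k s)%:E| <= dist j k)%E.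
    by apply: ge0_subset_integral => //; exact: measurable_itv.
  apply: le_trans; apply: fine_le => //.
  rewrite ge0_fin_numE; last by apply: integral_ge0 => s _.
  by apply: le_lt_trans le2 _; rewrite -ge0_fin_numE//; apply: integral_ge0 => s _.
have cvgF t : t \in `[0, T] -> f (uk k t) * g t @[k --> \oo] --> f (u t) * g t.
  move=> tT; apply: cvgMl; apply: (@cvg_comp _ _ _ (uk^~ t) f); last exact: cf.
  exact: cvgu.
have FTC k : (\int[lebesgue_measure]_(t in `[0%R, T]) (psik k t)%:E =
   (f (uk k T) * g T - f (uk k 0) * g 0)%:E)%E.
  by apply: continuous_chain_rule => // j; exact: cb.
pose G t := ((M * N')%:E + \sum_j (M * N)%:E * `|(a j t)%:E|)%E.
have iG : lebesgue_measure.-integrable `[0, T] G.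
  apply: integrableD; first exact: measurable_itv.
    apply: (measurable_bounded_integrable (f := cst (M * N'))) => //.
    by exists (M * N'); split; [exact: num_real|move=> x Mx t _ /=;
      rewrite ger0_norm ?mulr_ge0// ltW].
  apply: integrable_sum => [|j _]; first exact: measurable_itv.
  apply: integrableZl; first exact: measurable_itv.
  exact: integrable_abse (ia j).
have mu_ k : forall h : 'rV[R]_n -> R, continuous h ->
    measurable_fun `[0, T] (fun t => h (uk k t)).
  move=> h ch; apply: measurable_row_comp => // j.
  apply: subspace_continuous_measurable_fun => //.
  exact: primitive_within_continuous.
have mu (h : 'rV[R]_n -> R) : continuous h -> measurable_fun `[0, T] (fun t => h (u t)).
  move=> ch; apply: measurable_row_comp => // j.
  apply: subspace_continuous_measurable_fun => //.
  exact: primitive_within_continuous.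
have mphik k : measurable_fun `[0, T] (phik k).
  apply: measurable_funD.
    by apply: measurable_funM => //; exact: mu_.
  apply: measurable_sum => j; apply: measurable_funM => //.
  by apply: measurable_funM => //; apply: (mu_ _ ('D_(delta_mx 0 j) f)); have [] := Df j.
have mphi : measurable_fun `[0, T] phi.
  apply: measurable_funD.
    by apply: measurable_funM => //; exact: mu.
  apply: measurable_sum => j; apply: measurable_funM => //.
  by apply: measurable_funM => //; apply: (mu ('D_(delta_mx 0 j) f)); have [] := Df j.
have phiG k t : t \in `[0, T] -> (`|(phik k t)%:E| <= G t)%E.
  move=> tT; rewrite /G; under eq_bigr do rewrite -EFinM.
  rewrite sumEFin -EFinD lee_fin; apply: le_trans (ler_normD _ _) _.
  apply: lerD; first by rewrite normrM ler_pM// g'N.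
  apply: le_trans (ler_norm_sum _ _ _) _; apply: ler_sum => j _.
  by rewrite !normrM ler_wpM2r// ler_pM// gN.
have cvgphi t : t \in `[0, T] -> phik k t @[k --> \oo] --> phi t.
  move=> tT; apply: cvgD.
    apply: cvgMl; apply: (@cvg_comp _ _ _ (uk^~ t) f); last exact: cf.
    exact: cvgu.
  apply: (@cvg_big _ _ _ _ _ add_continuous) => j _; do 2 apply: cvgMl.
  apply: (@cvg_comp _ _ _ (uk^~ t) ('D_(delta_mx 0 j) f)); first exact: cvgu.
  by have [cD _] := Df j; exact: cD.
have mephik k : measurable_fun `[0, T] (fun t => (phik k t)%:E).
  exact: (measurable_EFinP _ _).2 (mphik k).
have mephi : measurable_fun `[0, T] (fun t => (phi t)%:E) by exact/measurable_EFinP.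
have aecvg : {ae lebesgue_measure, forall t, `[0, T]%classic t ->
    (phik k t)%:E @[k --> \oo] --> (phi t)%:E}.
  by apply/aeW => t tT; apply: cvg_EFin; [exact: nearW|exact: cvgphi].
have aeG : {ae lebesgue_measure, forall t k, `[0, T]%classic t ->
    (`|(phik k t)%:E| <= G t)%E}.
  by apply/aeW => t k tT; exact: phiG.
have [iphi _ cvgint] := @dominated_convergence _ (measurableTypeR R) R lebesgue_measure
  _ (measurable_itv _) _ _ _ mephik mephi aecvg iG aeG.
split=> //.
(* [err k] is [psik k - phik k]. The factors in front of [b j k - a j] are bounded by [M * N], so
   its integral tends to 0 with the L^1 distances. *)
pose err k t := \sum_j 'D_(delta_mx 0 j) f (uk k t) * g t * (b j k t - a j t).
pose H k t := (\sum_j (M * N)%:E * `|(a j t - b j k t)%:E|)%E.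
have iphik k : lebesgue_measure.-integrable `[0, T] (EFin \o phik k).
  apply: (le_integrable _ _ _ iG); first exact: measurable_itv.
  - exact: mephik.
  - by move=> t tT; apply: le_trans (phiG k t tT) _; rewrite lee_abs.
have iH k : lebesgue_measure.-integrable `[0, T] (H k).
  apply: integrable_sum => [|j _]; first exact: measurable_itv.
  apply: integrableZl; first exact: measurable_itv.
  exact: integrable_abse (iab j k).
have errH k t : t \in `[0, T] -> (`|(err k t)%:E| <= H k t)%E.
  move=> tT; rewrite /H; under eq_bigr do rewrite -EFinM.
  rewrite sumEFin lee_fin; apply: le_trans (ler_norm_sum _ _ _) _.
  apply: ler_sum => j _.
  by rewrite !normrM [X in _ * X <= _]distrC ler_wpM2r// ler_pM// gN.
have merr k : measurable_fun `[0, T] (err k).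
  apply: measurable_sum => j; apply: measurable_funM => //.
    by apply: measurable_funM => //; apply: (mu_ _ ('D_(delta_mx 0 j) f)); have [] := Df j.
  by apply: measurable_funB => //; apply/measurable_EFinP;
    exact: (measurable_int lebesgue_measure (ib j k)).
have meerr k : measurable_fun `[0, T] (fun t => (err k t)%:E) by exact/measurable_EFinP.
have ierr k : lebesgue_measure.-integrable `[0, T] (EFin \o err k).
  apply: (le_integrable _ _ _ (iH k)); first exact: measurable_itv.
  - exact: meerr.
  - by move=> t tT; apply: le_trans (errH k t tT) _; rewrite lee_abs.
have cvgerr :
    (\int[lebesgue_measure]_(t in `[0%R, T]) (err k t)%:E)%E @[k --> \oo] --> 0%E.
  apply/cvg_abse0P.
  apply: (@squeeze_cvge _ _ _ _ (cst 0%E) _ (fun k => \sum_j (M * N)%:E * dist j k)%E).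
  - apply: nearW => k; rewrite abse_ge0 /=.
    apply: le_trans (le_abse_integral _ _ _) _.
    + exact: measurable_itv.
    + exact: meerr.
    apply: (@le_trans _ _ (\int[lebesgue_measure]_(t in `[0%R, T]) H k t)%E).
      apply: ge0_le_integral => //.
      + exact: measurableT_comp (meerr k).
      + exact: measurable_int (iH k).
      + by move=> t; exact: errH.
    rewrite integral_sum; last 2 first.
    + exact: measurable_itv.
    + move=> j; apply: integrableZl; first exact: measurable_itv.
      exact: integrable_abse (iab j k).
    apply: lee_sum => j _; rewrite ge0_integralZl ?lee_fin ?mulr_ge0//.
      by apply: measurableT_comp => //; exact: (measurable_int _ (iab j k)).
  - exact: cvg_cst.
  - rewrite [X in _ --> X](_ : _ = \sum_(j < n) (M * N)%:E * 0)%E; last first.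
      by rewrite big1// => j _; rewrite mule0.
    apply: cvg_nnesum => [j _|j _].
      by apply: nearW => k; rewrite mule_ge0 ?lee_fin ?mulr_ge0// integral_ge0.
    by apply: cvgeZl => //; exact: dist0.
have FTC' k : ((f (uk k T) * g T - f (uk k 0) * g 0)%:E =
    \int[lebesgue_measure]_(t in `[0%R, T]) (phik k t)%:E +
    \int[lebesgue_measure]_(t in `[0%R, T]) (err k t)%:E)%E.
  rewrite -FTC -integralD; [|exact: measurable_itv|exact: iphik|exact: ierr].
  apply: eq_integral => t _; rewrite -EFinD; congr EFin.
  rewrite /psik /phik /err -addrA -big_split /=; congr (_ + _).
  by apply: eq_bigr => j _; ring.
(* The boundary terms converge in two ways, by convergence of the paths at 0 and [T] and by
   dominated convergence of the integrals; the two limits must coincide. *)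
have lim1 : (f (uk k T) * g T - f (uk k 0) * g 0)%:E @[k --> \oo] -->
    (f (u T) * g T - f (u 0) * g 0)%:E.
  apply: cvg_EFin; first exact: nearW.
  by apply: cvgB; apply: cvgF; rewrite in_itv /= lexx ltW.
have lim2 : (f (uk k T) * g T - f (uk k 0) * g 0)%:E @[k --> \oo] -->
    (\int[lebesgue_measure]_(t in `[0%R, T]) (phi t)%:E + 0)%E.
  under eq_fun do rewrite FTC'.
  by apply: cvgeD => //; exact: fin_num_adde_defl.
by rewrite adde0 in lim2; exact: (cvg_unique _ lim2 lim1).
Unshelve. all: by end_near. Qed.

(** * The quadratic pairing and the identification of the drift along the process *)

Lemma measurable_tensor_pairing d (X : measurableType d) (R : realType) (D : set X)
    (W : X -> Hm R) (f : R * R -> R * R -> R) : measurable D ->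
  (forall phi, measurable_fun D (fun x => W x phi)) ->
  measurable_fun D (fun x => pair2 (W x) f).
Proof.
(* [pair2] is a [limn] of finite sums that are polynomial in evaluations of [W x]; points where
   these sums diverge are covered by [measurable_limn]. *)
move=> mD mW; apply: measurable_limn => // N.
apply: measurable_sum => k; apply: measurable_sum => l.
apply: measurable_funD; apply: measurable_funM => //.
  by apply: measurable_funB; exact: measurable_funM.
by apply: measurable_funD; exact: measurable_funM.
Qed.

(** Pointwise, [|f|] is at most [e] or at most [f ^+ 2 / e], and [mu] has mass one. Letting first
    the L^2 norm and then [e] tend to 0, this turns L^2 convergence into L^1 convergence. *)
Lemma integral_abs_le_sqr d (Y : measurableType d) (R : realType) (mu : probability Y R)
    (f : Y -> R) (e : R) : measurable_fun setT f -> 0 < e ->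
  (\int[mu]_y `|(f y)%:E| <= e%:E + e^-1%:E * \int[mu]_y (f y ^+ 2)%:E)%E.
Proof.
move=> mf e0.
have mf2 : measurable_fun setT (fun y => (f y ^+ 2)%:E).
  by apply/measurable_EFinP; apply: measurable_funX.
rewrite -ge0_integralZl//; last 2 first.
- by move=> y _; rewrite lee_fin sqr_ge0.
- by rewrite lee_fin invr_ge0 ltW.
have -> : e%:E = (\int[mu]_y (cst e%:E y))%E.
  rewrite integral_cst// -[LHS]mule1; congr (_ * _)%E.
  exact/esym/probability_setT.
rewrite -ge0_integralD//; last 3 first.
- by move=> y _; rewrite lee_fin ltW.
- by move=> y _; rewrite -EFinM lee_fin mulr_ge0 ?sqr_ge0// invr_ge0 ltW.
- by apply: emeasurable_funM.
apply: ge0_le_integral => //.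
- by apply: measurableT_comp => //; exact/measurable_EFinP.
- by apply: emeasurable_funD => //; apply: emeasurable_funM.
move=> y _ /=; rewrite -EFinM -EFinD lee_fin.
have [fe|ef] := leP `|f y| e.
  by rewrite (le_trans fe)// lerDl mulr_ge0 ?sqr_ge0// invr_ge0 ltW.
have : `|f y| <= e^-1 * f y ^+ 2.
  rewrite mulrC ler_pdivlMr// -[f y ^+ 2]real_normK ?num_real// expr2.
  by rewrite ler_wpM2l// ltW.
by move/le_trans; apply; rewrite lerDr ltW.
Qed.

Section Identification.
Context d (Xi : measurableType d) (R : realType) (P : probability Xi R)
  (mu : probability (Hm R) R) (T M : R) (rho : R -> Hm R -> R) (om : Xi -> R -> Hm R).
Hypotheses (T0 : 0 < T)
  (mrho : forall t, t \in `[0, T] -> measurable_fun setT (rho t))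
  (rho_bnd : forall t w, t \in `[0, T] -> 0 <= rho t w <= M)
  (mom : forall t, t \in `[0, T] -> measurable_fun setT (om ^~ t))
  (law : forall t, t \in `[0, T] -> forall A, measurable A ->
     P ((om ^~ t) @^-1` A) = (\int[mu]_(w in A) (rho t w)%:E)%E).
Let D : set (Xi * measurableTypeR R) := setT `*` `[0, T].

Let rho_ge0 t : t \in `[0, T] -> forall w, 0 <= rho t w.
Proof. by move=> tT w; have /andP[] := rho_bnd t w tT. Qed.

(** [V n] stands for the pairing with the n-th member of an admissible sequence. At time [s] the
    L^1(P) distance from [A] to [B] is at most that from [A] to [V n] plus that from [V n] to [B];
    the latter is at most [M] times the L^1(mu) distance, since the law of [om ^~ s] has density at
    most [M]. *)
Lemma ae_identification (A : Xi -> R -> R) (B : Hm R -> R) (V : nat -> Hm R -> R) :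
  measurable_fun D (fun z => A z.1 z.2) -> measurable_fun setT B ->
  (forall n, measurable_fun setT (V n)) ->
  (forall n, measurable_fun D (fun z => V n (om z.1 z.2))) ->
  (\int[P]_x \int[lebesgue_measure]_(s in `[0%R, T])
      `|(V n (om x s) - A x s)%:E|)%E @[n --> \oo] --> 0%E ->
  (\int[mu]_w ((V n w - B w) ^+ 2)%:E)%E @[n --> \oo] --> 0%E ->
  {ae lebesgue_measure, forall s, s \in `[0, T] ->
     {ae P, forall x, A x s = B (om x s)}}.
Proof.
move=> mA mB mV mW cvgA cvgB.
have mD : measurable D by apply: measurableX.
(* Extension by zero off [D] lets Tonelli be applied on the full product. *)
pose h n := (fun z : Xi * measurableTypeR R =>
  `|(V n (om z.1 z.2) - A z.1 z.2)%:E|%E) \_ D.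
have mh n : measurable_fun setT (h n).
  apply/measurable_restrict => //; rewrite setTI.
  by apply: measurableT_comp => //; apply/measurable_EFinP; exact: measurable_funB.
have h0 n z : (0 <= h n z)%E by rewrite /h patchE; case: ifP.
have hE n x s : s \in `[0, T] -> h n (x, s) = `|(V n (om x s) - A x s)%:E|%E.
  by move=> sT; rewrite /h patchE mem_set.
pose E n s := (\int[P]_x h n (x, s))%E.
have mE n : measurable_fun setT (E n) by exact: measurable_fun_fubini_tonelli_G.
have E0 n s : (0 <= E n s)%E by exact: integral_ge0.
have cvgE : (\int[lebesgue_measure]_s E n s)%E @[n --> \oo] --> 0%E.
  apply: cvg_trans cvgA; apply: near_eq_cvg; apply: nearW => n.
  rewrite -fubini_tonelli//; apply: eq_integral => x _.
  rewrite [LHS]integral_mkcond; apply: eq_integral => s _.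
  rewrite patchE /h patchE; congr (if _ then _ else _).
  by rewrite /D in_setX /= in_setT.
pose q n := (\int[mu]_w ((V n w - B w) ^+ 2)%:E)%E.
pose c n := (\int[mu]_w `|(V n w - B w)%:E|)%E.
have c0 n : (0 <= c n)%E by exact: integral_ge0.
have M0 : 0 <= M.
  have : 0 <= rho 0 point <= M by apply: rho_bnd; rewrite in_itv /= lexx ltW.
  by case/andP; exact: le_trans.
(* For every n, Eb n s bounds the L^1(P) distance between A(s) and B(w_s). *)
pose Eb n s := (E n s + M%:E * c n)%E.
have mEb n : measurable_fun setT (Eb n) by apply: emeasurable_funD => //.
have Eb0 n s : (0 <= Eb n s)%E by rewrite adde_ge0 ?mule_ge0 ?lee_fin.
(* Convergence in L^1(0, T) does not give convergence at a fixed [s]. The infimum over [n] replaces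
   the extraction of a subsequence: its integral is 0, so it vanishes for almost every [s]. *)
pose L s := einfs (Eb ^~ s) 0%N.
have mL : measurable_fun `[0, T] L.
  by apply: measurable_funTS; apply: measurable_fun_einfs.
have L0 s : (0 <= L s)%E by apply: le_ereal_inf_tmp => _ [n _ <-].
have LE n s : (L s <= Eb n s)%E by apply: ereal_inf_lbound; exists n.
have intL_le e : 0 < e ->
    (\int[lebesgue_measure]_(s in `[0%R, T]) L s <= (M * e * T)%:E)%E.
  move=> e0.
  pose r n := ((\int[lebesgue_measure]_s E n s) +
    M%:E * (e%:E + e^-1%:E * q n) * T%:E)%E.
  have rE : r n @[n --> \oo] --> (M * e * T)%:E.
    rewrite (_ : (M * e * T)%:E = 0 + M%:E * (e%:E + e^-1%:E * 0) * T%:E)%E; last first.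
      by rewrite mule0 adde0 add0e -!EFinM.
    apply: cvgeD => //; apply: cvgeZr => //; apply: cvgeZl => //.
    apply: cvgeD => //.
    - exact: cvg_cst.
    - by apply: cvgeZl.
  apply: cvge_ge rE; apply: nearW => n.
  apply: (@le_trans _ _ (\int[lebesgue_measure]_(s in `[0%R, T]) Eb n s)%E).
    by apply: ge0_le_integral => //; exact: measurable_funTS.
  rewrite ge0_integralD//; last 2 first.
  - exact: measurable_funTS.
  - by move=> s _; rewrite mule_ge0 ?lee_fin.
  apply: leeD.
    exact: ge0_subset_integral.
  rewrite integral_cst//.
  rewrite [X in (_ * X <= _)%E](_ : _ = T%:E); last first.
    by have := @lebesgue_measure_itv R `[0, T]; rewrite /= lte_fin T0 sube0.
  apply: lee_wpmul2r; first by rewrite lee_fin ltW.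
  apply: lee_wpmul2l; first by rewrite lee_fin.
  by apply: integral_abs_le_sqr => //; exact: measurable_funB.
have intL : (\int[lebesgue_measure]_(s in `[0%R, T]) L s = 0)%E.
  apply/eqP; rewrite eq_le integral_ge0// andbT.
  apply/lee_addgt0Pr => e e0; rewrite add0e.
  (* Adding 1 keeps the divisor positive even when [M] is 0. *)
  have MT : 0 < M * T + 1 by rewrite ltr_wpDl// mulr_ge0// ltW.
  apply: le_trans (intL_le _ (divr_gt0 e0 MT)) _.
  rewrite lee_fin mulrAC mulrA ler_pdivrMr// mulrC ler_pM2l//.
  by rewrite lerDl.
have aeL : ae_eq lebesgue_measure `[0, T]%classic L (cst 0%E).
  apply/ae_eq_integral_abs => //.
  by rewrite -[RHS]intL; apply: eq_integral => s _; rewrite gee0_abs.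
apply: filterS aeL => s Ls sT.
have {}Ls : L s = 0%E by exact: Ls.
have ms : measurable_fun setT (fun x : Xi => (x, s) : Xi * measurableTypeR R).
  by apply: measurable_fun_pair.
have msec (k : Xi -> R -> R) : measurable_fun D (fun z => k z.1 z.2) ->
    measurable_fun setT (k ^~ s).
  move=> mk; apply: (@measurable_comp _ _ _ _ _ _ D (fun z => k z.1 z.2) setT
    (fun x => (x, s))) => //.
  by move=> _ [x _ <-].
have mAs := msec _ mA.
have mBs : measurable_fun setT (fun x => B (om x s)).
  exact: measurableT_comp mB (mom _ sT).
have mWs n : measurable_fun setT (fun x => V n (om x s)).
  exact: measurableT_comp (mV n) (mom _ sT).
have key n : (\int[P]_x `|(A x s - B (om x s))%:E| <= Eb n s)%E.
  apply: (@le_trans _ _ (\int[P]_x (h n (x, s) + `|(V n (om x s) - B (om x s))%:E|))%E).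
    apply: ge0_le_integral => //.
    - by apply: measurableT_comp => //; apply/measurable_EFinP; exact: measurable_funB.
    - apply: emeasurable_funD; first exact: measurableT_comp (mh n) ms.
      by apply: measurableT_comp => //; apply/measurable_EFinP; exact: measurable_funB.
    - move=> x _; rewrite hE// addeC.
      suff : `|A x s - B (om x s)| <=
          `|V n (om x s) - B (om x s)| + `|V n (om x s) - A x s| by [].
      rewrite (_ : A x s - B (om x s) =
        (V n (om x s) - B (om x s)) - (V n (om x s) - A x s)); last by ring.
      exact: ler_normB.
  rewrite ge0_integralD//; last 2 first.
  - exact: measurableT_comp (mh n) ms.
  - by apply: measurableT_comp => //; apply/measurable_EFinP; exact: measurable_funB.
  apply: leeD => //.
  have mVB : measurable_fun setT (fun w => `|(V n w - B w)%:E|%E).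
    by apply: measurableT_comp => //; apply/measurable_EFinP; exact: measurable_funB.
  (* The expectation becomes an integral against [rho s] times [mu], and [rho s] is then bounded by
     [M]. *)
  rewrite (ge0_integral_law _ _ _ _ _ _ _ _ _ (mrho _ sT) (rho_ge0 _ sT) (mom _ sT)
    (law _ sT) (fun w => `|(V n w - B w)%:E|%E))//.
  rewrite -ge0_integralZl//.
  apply: ge0_le_integral => //.
  - by move=> w _; rewrite mule_ge0 ?lee_fin ?rho_ge0.
  - by apply: emeasurable_funM => //; apply/measurable_EFinP; exact: mrho.
  - by apply: emeasurable_funM.
  - move=> w _; rewrite muleC lee_wpmul2r// lee_fin.
    by have /andP[] := rho_bnd _ w sT.
have {}key : (\int[P]_x `|(A x s - B (om x s))%:E| = 0)%E.
  apply/eqP; rewrite eq_le integral_ge0// andbT -Ls.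
  by apply: le_ereal_inf_tmp => _ [n _ <-]; exact: key.
have mAB : measurable_fun setT (fun x => (A x s - B (om x s))%:E).
  by apply/measurable_EFinP; exact: measurable_funB.
have := (@ae_eq_integral_abs _ _ _ P setT measurableT _ mAB).1 key.
apply: filterS => x /(_ I) [] /eqP.
by rewrite subr_eq0 => /eqP.
Qed.
End Identification.

(** Tonelli handles the positive and negative parts separately, and the integral is their difference
    by definition, so a signed [K] need not be integrable. *)
Lemma measurable_fun_integral d1 d2 (X : measurableType d1) (Y : measurableType d2)
    (R : realType) (mu : {sigma_finite_measure set Y -> \bar R}) (K : X * Y -> \bar R) :
  measurable_fun setT K -> measurable_fun setT (fun x => \int[mu]_y K (x, y))%E.
Proof.
move=> mK.
have -> : (fun x => \int[mu]_y K (x, y))%E =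
    (fun x => \int[mu]_y K^\+ (x, y) - \int[mu]_y K^\- (x, y))%E.
  by apply/funext => x; rewrite integralE; congr (_ - _)%E;
    apply: eq_integral => y _; rewrite ?funeposE ?funenegE.
by apply: emeasurable_funB; apply: measurable_fun_fubini_tonelli_F => //;
  [exact: measurable_funepos|exact: measurable_funeneg].
Qed.

(** * The integrand of the weak formulation and its integral along a path *)

Section CylinderDrift.
Context (R : realType) (T : R) (F : cylinder T).

(* Integrand of the weak formulation, with [b j] in the role of <w (x) w, H_{phi_j}>. *)
Definition cyl_gen (b : 'I_(cyl_n F) -> R) (t : R) (w : Hm R) : R :=
  \sum_(i < cyl_m F) (cyl_f i (cyl_arg F w) * (cyl_g i)^`()%classic t +
    \sum_(j < cyl_n F) 'D_(delta_mx 0 j) (cyl_f i) (cyl_arg F w) * cyl_g i t * b j).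

Lemma cyl_genE (B : test R -> Hm R -> R) t w :
  cyl_dt F t w + cyl_drift F B t w = cyl_gen (fun j => B (cyl_phi j) w) t w.
Proof. by rewrite /cyl_gen big_split. Qed.

Lemma cyl_C1b i : C1b (@cyl_f R T F i). Proof. by case: F i. Qed.
Lemma cyl_C1_itv i : C1_itv T (@cyl_g R T F i). Proof. by case: F i. Qed.
Lemma cyl_gT i : @cyl_g R T F i T = 0. Proof. by case: F i. Qed.

Hypothesis T0 : 0 < T.

(** Growth is at most linear in the drift values, uniformly in time and state, so integrability of
    the drift carries over to the integrand. *)
Lemma cyl_gen_bound : exists C, 0 <= C /\ forall b t w, t \in `[0, T] ->
  `|cyl_gen b t w| <= C + \sum_j C * `|b j|.
Proof.
have /choice[M HM] i := C1b_bound _ _ _ (cyl_C1b i).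
have /choice[N HN] i : exists N, 0 <= N /\
    forall t, t \in `[0, T] -> `|@cyl_g R T F i t| <= N.
  have [cg _ _] := cyl_C1_itv i.
  exact: within_continuous_itv_bound (ltW T0) cg.
have /choice[N' HN'] i := (C1_itv_derive_bound _ _ _ T0 (cyl_C1_itv i)).2.
(* [M i] bounds [cyl_f i] and its partial derivatives, [N i] bounds [cyl_g i] and [N' i] its
   derivative; the sum serves both kinds of terms. *)
pose C := \sum_i M i * (N i + N' i).
have H i : 0 <= M i /\ 0 <= N i /\ 0 <= N' i.
  by have [? _ _] := HM i; have [? _] := HN i; have [? _] := HN' i.
exists C; split; first by apply: sumr_ge0 => i _; have [? [? ?]] := H i;
  rewrite mulr_ge0// addr_ge0.
move=> b t w tT; apply: le_trans (ler_norm_sum _ _ _) _.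
have -> : C + \sum_j C * `|b j| = \sum_i (M i * (N i + N' i) +
    \sum_j M i * (N i + N' i) * `|b j|).
  rewrite big_split /=; congr (_ + _); rewrite exchange_big /=.
  by apply: eq_bigr => j _; rewrite mulr_suml.
apply: ler_sum => i _; apply: le_trans (ler_normD _ _) _.
have [M0 [N0 N'0]] := H i.
have [_ fM DfM] := HM i; have [_ gN] := HN i; have [_ g'N] := HN' i.
apply: lerD.
  by rewrite normrM ler_pM// (le_trans (g'N _ tT))// lerDr.
apply: le_trans (ler_norm_sum _ _ _) _; apply: ler_sum => j _.
by rewrite !normrM ler_wpM2r// ler_pM// (le_trans (gN _ tT))// lerDl.
Qed.

Section Measurability.
Context d (X : measurableType d) (D : set X) (W : X -> Hm R) (s : X -> measurableTypeR R)
  (b : 'I_(cyl_n F) -> X -> R).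
Hypotheses (mD : measurable D) (mW : forall phi, measurable_fun D (fun x => W x phi))
  (ms : measurable_fun D s) (sT : forall x, D x -> s x \in `[0, T])
  (mb : forall j, measurable_fun D (b j)).

Lemma measurable_time_comp (g : R -> R) : measurable_fun `[0, T] g ->
  measurable_fun D (fun x => g (s x)).
Proof.
move=> mg; apply: (@measurable_comp _ _ _ _ _ _ `[0, T]%classic g D s) => //.
by move=> _ [x Dx <-]; exact: sT.
Qed.

Lemma measurable_cyl_g i : measurable_fun D (fun x => @cyl_g R T F i (s x)).
Proof.
apply: measurable_time_comp; have [cg _ _] := cyl_C1_itv i.
exact: subspace_continuous_measurable_fun.
Qed.

Lemma measurable_cyl_f i : measurable_fun D (fun x => @cyl_f R T F i (cyl_arg F (W x))).
Proof.
apply: measurable_row_comp => //; exact: (C1b_continuous _ _ _ (cyl_C1b i)).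
Qed.

(** State, time and drift are arbitrary measurable maps because three cases occur: the process on
    [Xi] times [0, T], the product of [0, T] with H^{-1-}, and H^{-1-} at a fixed time. *)
Lemma measurable_cyl_gen : measurable_fun D (fun x => cyl_gen (b ^~ x) (s x) (W x)).
Proof.
apply: measurable_sum => i; apply: measurable_funD.
  apply: measurable_funM; first exact: measurable_cyl_f.
  apply: measurable_time_comp; exact: (C1_itv_derive_bound _ _ _ T0 (cyl_C1_itv i)).1.
apply: measurable_sum => j; apply: measurable_funM => //.
apply: measurable_funM; last exact: measurable_cyl_g.
apply: (measurable_row_comp _ _ _ _ _ ('D_(delta_mx 0 j) (@cyl_f R T F i))) => //.
by have [_ _ Df] := cyl_C1b i; have [] := Df j.
Qed.

End Measurability.
End CylinderDrift.
Arguments cyl_gen {R T} F b t w.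

(** The chain rule is applied to each summand of [F]; the boundary term at [T] vanishes because
    [cyl_g i T = 0], leaving the one at 0. *)
Lemma integral_cyl_path (R : realType) (T : R) (F : cylinder T) (w : R -> Hm R)
    (a : 'I_(cyl_n F) -> R -> R) : 0 < T ->
  (forall j, lebesgue_measure.-integrable `[0, T] (EFin \o a j)) ->
  (forall j t, t \in `[0, T] -> w t (cyl_phi j) =
     w 0 (cyl_phi j) + \int[lebesgue_measure]_(s in `[0, t]) a j s) ->
  (\int[lebesgue_measure]_(t in `[0%R, T]) (cyl_gen F (a ^~ t) t (w t))%:E =
   (- cyl_eval F 0 (w 0))%:E)%E.
Proof.
move=> T0 ia wE.
pose u t : 'rV[R]_(cyl_n F) :=
  \row_j (w 0 (cyl_phi j) + \int[lebesgue_measure]_(s in `[0, t]) a j s).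
have uE t : t \in `[0, T] -> cyl_arg F (w t) = u t.
  by move=> tT; apply/rowP => j; rewrite !mxE wE.
pose phi i t := @cyl_f R T F i (u t) * (@cyl_g R T F i)^`()%classic t +
  \sum_j 'D_(delta_mx 0 j) (@cyl_f R T F i) (u t) * @cyl_g R T F i t * a j t.
have H i := integrable_chain_rule _ _ _ _ _ (fun j => w 0 (cyl_phi j)) _
  T0 (cyl_C1b _ _ F i) (cyl_C1_itv _ _ F i) ia.
transitivity (\int[lebesgue_measure]_(t in `[0%R, T]) \sum_i (phi i t)%:E)%E.
  apply: eq_integral => t; rewrite inE => tT.
  by rewrite sumEFin /cyl_gen uE.
rewrite integral_sum//; last by move=> i; have [] := H i.
transitivity (\sum_i (- (@cyl_f R T F i (u 0) * @cyl_g R T F i 0))%:E)%E.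
  apply: eq_bigr => i _; have [_ ->] := H i.
  by rewrite cyl_gT mulr0 sub0r.
rewrite sumEFin sumrN /cyl_eval uE// in_itv /= lexx ltW//.
Qed.

(** * From the process to the continuity equation *)

Theorem proposition32 (R : realType) (T : R) (hT : 0 < T)
    (G : R * R -> R) (hG : green G)
    (mu : probability (Hm R) R) (hmu : white_noise_law mu)
    (B : test R -> Hm R -> R) (hB : forall phi, Hpairing G mu phi (B phi))
    (rho0 : Hm R -> R) (rho0_cont : continuous rho0)
    (rho0_bdd : exists M : R, forall w, `|rho0 w| <= M)
    (rho0_ge0 : forall w, 0 <= rho0 w)
    (rho0_int1 : (\int[mu]_w (rho0 w)%:E)%E = 1%E)
    (rho : R -> Hm R -> R)
    (rho_meas : measurable_fun
       (`[0, T] `*` setT : set (measurableTypeR R * Hm R))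
       (fun z => rho z.1 z.2))
    (rho_bound : forall t w, t \in `[0, T] ->
       0 <= rho t w <= sup [set `|rho0 v| | v in [set: Hm R]])
    (rho_init : {ae mu, forall w, rho 0 w = rho0 w})
    (rho_process : exists (d : measure_display) (Xi : measurableType d)
       (P : probability Xi R) (om : Xi -> R -> Hm R),
       white_noise_solution T P G mu rho om /\ limit_of_vortices T P G om) :
  bounded_weak_solution T mu B rho rho0.
Proof.
set M := sup _ in rho_bound.
have T00 : 0 \in `[0, T] by rewrite in_itv /= lexx ltW.
have [d [Xi [P [om [[dens mom _ law sol] _]]]]] := rho_process.
have mrho t : t \in `[0, T] -> measurable_fun setT (rho t).
  by have [C [q [_ _ H]]] := dens; move=> /H[].
have rho_ge0 t : t \in `[0, T] -> forall w, 0 <= rho t w.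
  by move=> tT w; have /andP[] := rho_bound t w tT.
(* Borel measurability of evaluations is part of [centered_gaussian]. *)
have mev phi : measurable_fun setT (fun w : Hm R => w phi) by exact: (hmu.1 phi).1.
split=> //; first by exists M.
move=> F.
have /choice[A HA] (j : 'I_(cyl_n F)) : exists A,
    nonlinear_process T P G om (cyl_phi j) A /\
    {ae P, forall x, forall t, t \in `[0, T] -> om x t (cyl_phi j) =
      om x 0 (cyl_phi j) + \int[lebesgue_measure]_(s in `[0, t]) A x s}.
  by have [_ [A A1 A2]] := sol (cyl_phi j); exists A.
pose D : set (Xi * measurableTypeR R) := setT `*` `[0, T].
have mD : measurable D by apply: measurableX.
have iA j : (P \x @lebesgue_measure R)%E.-integrable D (fun z => (A j z.1 z.2)%:E).
  by have [[]] := HA j.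
have mA j : measurable_fun D (fun z => A j z.1 z.2).
  by apply/measurable_EFinP; exact: measurable_int (iA j).
have mB phi : measurable_fun setT (B phi) by have [] := hB phi.
have aeId : {ae lebesgue_measure, forall s : measurableTypeR R, s \in `[0, T] -> forall j,
    {ae P, forall x, A j x s = B (cyl_phi j) (om x s)}}.
  have H j : {ae lebesgue_measure, forall s : measurableTypeR R, s \in `[0, T] ->
      {ae P, forall x, A j x s = B (cyl_phi j) (om x s)}}.
    (* Both limits hold along every admissible sequence, so the one whose existence comes with [B]
       also serves for [A j]. *)
    have [_ _ [[Hn adm] cvgB]] := hB (cyl_phi j).
    have [[_ [_ cvgA]] _] := HA j.
    apply: (ae_identification _ _ _ P mu T M rho om hT mrho rho_bound _ _
      (A j) (B (cyl_phi j)) (fun n w => pair2 w (Hn n))) => //.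
    - by move=> t /law[].
    - by move=> t /law[].
    - by move=> n; apply: (measurable_tensor_pairing _ (Hm R) R setT id (Hn n)).
    - by move=> n; apply: (measurable_tensor_pairing _ _ _ D (fun z => om z.1 z.2)).
    - exact: cvgA.
    - exact: cvgB.
  by apply: filterS (filter_forall _ H) => s Hs sT j; exact: Hs.
pose Psi (z : Xi * measurableTypeR R) :=
  cyl_gen F (fun j => A j z.1 z.2) z.2 (om z.1 z.2).
have mPsi : measurable_fun D Psi.
  apply: (measurable_cyl_gen _ _ F hT _ _ D (fun z => om z.1 z.2) snd
    (fun j z => A j z.1 z.2)) => //.
    by apply: measurable_funTS; exact: measurable_snd.
  by move=> z [_].
have iPsi : (P \x @lebesgue_measure R)%E.-integrable D (EFin \o Psi).
  (* The dominating function is a constant, integrable since [D] has measure [T], plus a multiple of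
     the sum of the integrable [A j] in absolute value. *)
  have [C [C0 HC]] := cyl_gen_bound _ _ F hT.
  pose H (z : Xi * measurableTypeR R) := (C%:E + \sum_j C%:E * `|(A j z.1 z.2)%:E|)%E.
  have iH : (P \x @lebesgue_measure R)%E.-integrable D H.
    apply: integrableD => //.
      apply: (measurable_bounded_integrable (f := cst C)) => //.
        have DE : (P \x @lebesgue_measure R)%E D = T%:E.
          rewrite [LHS](product_measure1E P (@lebesgue_measure R))//.
          rewrite -[RHS]mul1e; congr (_ * _)%E; first exact: probability_setT.
          by have := @lebesgue_measure_itv R `[0, T]; rewrite /= lte_fin hT sube0.
        by rewrite [X in (X < _)%E]DE ltry.
      by exists C; split; [exact: num_real|move=> x Cx z _ /=; rewrite ger0_norm// ltW].
    apply: integrable_sum => // j _; apply: integrableZl => //.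
    exact: integrable_abse (iA j).
  apply: (le_integrable _ _ _ iH) => //; first exact/measurable_EFinP.
  move=> z [_ zT]; apply: le_trans (lee_abs _).
  rewrite /H; under eq_bigr do rewrite -EFinM.
  by rewrite sumEFin -EFinD lee_fin; exact: HC.
pose PsiD := (EFin \o Psi) \_ D.
have iPsiD : (P \x @lebesgue_measure R)%E.-integrable setT PsiD.
  exact: (integrable_mkcond _ mD).1 iPsi.
have PsiDE x t : t \in `[0, T] -> PsiD (x, t) = (Psi (x, t))%:E.
  by move=> tT; rewrite /PsiD patchE mem_set.
have PsiD0 x t : t \notin `[0, T] -> PsiD (x, t) = 0%E.
  move=> tT; rewrite /PsiD patchE memNset// => -[_ /=].
  exact/negP.
pose K (z : measurableTypeR R * Hm R) :=
  ((cyl_dt F z.1 z.2 + cyl_drift F B z.1 z.2) * rho z.1 z.2)%:E.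
pose D' : set (measurableTypeR R * Hm R) := `[0, T] `*` setT.
have mD' : measurable D' by apply: measurableX.
have mK : measurable_fun setT (K \_ D').
  apply/measurable_restrict => //; rewrite setTI; apply/measurable_EFinP.
  apply: measurable_funM => //.
  apply: (eq_measurable_fun (fun z : measurableTypeR R * Hm R =>
    cyl_gen F (fun j => B (cyl_phi j) z.2) z.1 z.2)).
    by move=> z _; rewrite cyl_genE.
  apply: (measurable_cyl_gen _ _ F hT _ _ D' snd fst
    (fun j z => B (cyl_phi j) z.2)) => //.
  - by move=> phi; apply: measurable_funTS; exact: measurableT_comp (mev phi) measurable_snd.
  - by apply: measurable_funTS; exact: measurable_fst.
  - by move=> z [].
  - by move=> j; apply: measurable_funTS; exact: measurableT_comp (mB _) measurable_snd.
(* Measurability in [t] of the inner integral is what allows it to be replaced for almost every [t]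
   below. *)
have mIK : measurable_fun `[0, T] (fun t => \int[mu]_w
    ((cyl_dt F t w + cyl_drift F B t w) * rho t w)%:E)%E.
  apply: (eq_measurable_fun (fun t => \int[mu]_w (K \_ D') (t, w))%E).
    move=> t tT; apply: eq_integral => w _.
    by rewrite patchE mem_set//; split => //; exact: set_mem.
  by apply: measurable_funTS; exact: measurable_fun_integral.
have mIPsi : measurable_fun setT (fun t => \int[P]_x PsiD (x, t))%E.
  exact: (measurable_fubini_G iPsiD).
(* For almost every [t], the law of [om ^~ t] turns the integral against [rho t] times [mu] into an
   expectation, in which [B (cyl_phi j)] along the process may be replaced by [A j]. *)
transitivity (\int[lebesgue_measure]_(t in `[0%R, T]) \int[P]_x PsiD (x, t))%E.
  apply: ae_eq_integral => //.
    exact: measurable_funTS.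
  apply: filterS aeId => t Ht tT; have {}Ht := Ht tT.
  under eq_integral do rewrite cyl_genE.
  pose k w := cyl_gen F (fun j => B (cyl_phi j) w) t w.
  have mk : measurable_fun setT k.
    apply: (measurable_cyl_gen _ _ F hT _ _ setT id (cst t)
      (fun j => B (cyl_phi j))) => //.
  have [mt lawt] := law _ tT.
  rewrite -(integral_law _ _ _ _ _ P mu (rho t) (om ^~ t) (mrho _ tT)
    (rho_ge0 _ tT) mt lawt k)//.
  apply: ae_eq_integral => //.
  - by apply/measurable_EFinP; exact: measurableT_comp mk mt.
  - apply: measurableT_comp (measurable_int _ iPsiD) _.
    exact: measurable_fun_pair.
  apply: filterS (filter_forall _ Ht) => x Hx _.
  rewrite PsiDE// /Psi /k /=; congr (EFin _).
  rewrite /cyl_gen; apply: eq_bigr => i _; congr (_ + _).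
  by apply: eq_bigr => j _; rewrite Hx.
transitivity (\int[lebesgue_measure]_t \int[P]_x PsiD (x, t))%E.
  rewrite [LHS]integral_mkcond; apply: eq_integral => t _.
  rewrite patchE; case: ifPn => // tT.
  by rewrite integral0_eq// => x _; apply: PsiD0; apply: contra tT; rewrite inE.
rewrite -(Fubini iPsiD).
have me : measurable_fun setT (cyl_eval F 0).
  apply: measurable_sum => i; apply: measurable_funM => //.
  exact: (measurable_cyl_f _ _ F _ _ setT id).
have [m0 law0] := law _ T00.
transitivity (\int[P]_x (- cyl_eval F 0 (om x 0))%:E)%E.
  apply: ae_eq_integral => //.
  - exact: (measurable_fubini_F iPsiD).
  - apply/measurable_EFinP; apply: measurableT_comp => //.
    exact: measurableT_comp me m0.
  (* By Fubini, integrability of [A j] on the product passes to almost every path, where the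
     pathwise formula then applies. *)
  have aeI : {ae P, forall x, forall j,
      lebesgue_measure.-integrable `[0, T] (EFin \o A j x)}.
    apply: filter_forall => j.
    have : (P \x @lebesgue_measure R)%E.-integrable setT
        ((fun z => (A j z.1 z.2)%:E) \_ D) by exact: (integrable_mkcond _ mD).1 (iA j).
    move=> /ae_integrable1; apply: filterS => x ix.
    apply/integrable_mkcond => //; apply: eq_integrable ix => // s _.
    rewrite !patchE /D in_setX /= in_setT //.
  have aeJ : {ae P, forall x, forall j t, t \in `[0, T] -> om x t (cyl_phi j) =
      om x 0 (cyl_phi j) + \int[lebesgue_measure]_(s in `[0, t]) A j x s}.
    by apply: filter_forall => j; have [] := HA j.
  apply: filterS2 aeI aeJ => x Ix Jx _.
  rewrite -(integral_cyl_path _ _ _ (om x) (A ^~ x))// [RHS]integral_mkcond.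
  apply: eq_integral => t _; rewrite [RHS]patchE; case: ifPn => tT.
    by rewrite PsiDE//; move: tT; rewrite inE.
  by apply: PsiD0; apply: contra tT; rewrite inE.
have mNe : measurable_fun setT (fun w => - cyl_eval F 0 w) by exact: measurableT_comp.
rewrite (integral_law _ _ _ _ _ P mu (rho 0) (om ^~ 0) (mrho _ T00) (rho_ge0 _ T00)
  m0 law0 (fun w => - cyl_eval F 0 w))//.
have mrho0 : measurable_fun setT rho0.
  apply: (measurability _ (RGenOInfty.measurableE R)) => // _ [_ [a ->] <-].
  rewrite setTI; apply: sub_sigma_algebra.
  by move/continuousP: rho0_cont; apply; exact: interval_open.
have [C HC] : exists C, forall w, `|cyl_eval F 0 w| <= C.
  have /choice[N HN] i := C1b_bound _ _ _ (cyl_C1b _ _ F i).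
  exists (\sum_i N i * `|@cyl_g R T F i 0|) => w.
  apply: le_trans (ler_norm_sum _ _ _) _; apply: ler_sum => i _.
  by rewrite normrM ler_wpM2r//; have [_ H _] := HN i; exact: H.
(* The law at time 0 produced the density [rho 0], which agrees with [rho0] almost everywhere. *)
transitivity (\int[mu]_w (- (cyl_eval F 0 w * rho0 w)%:E))%E.
  apply: ae_eq_integral => //.
  - by apply/measurable_EFinP; apply: measurable_funM => //; exact: mrho.
  - by apply: measurableT_comp => //; apply/measurable_EFinP; exact: measurable_funM.
  by apply: filterS rho_init => w -> _; rewrite mulNr.
have [M' HM'] := rho0_bdd.
(* Both factors are bounded and [mu] is finite, so the minus sign can leave the integral. *)
have ie : mu.-integrable setT (EFin \o (fun w => cyl_eval F 0 w * rho0 w)).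
  apply: measurable_bounded_integrable => //.
  - apply: (@le_lt_trans _ _ 1%E); last by rewrite ltry.
    by rewrite le_eqVlt; apply/orP; left; apply/eqP; exact: probability_setT.
  - exact: measurable_funM.
  exists (C * M'); split; first exact: num_real.
  move=> x Cx w _ /=; rewrite normrM (le_trans _ (ltW Cx))// ler_pM//.
by rewrite integralN//; exact: integrable_add_def ie.
Qed.
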